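(* Let $N$ be a nonlinear connection on $E^*=J^{1*}(\mathcal T,M)$ and let $D$ be an $N$-linear connection with adapted coefficients $D\Gamma(N)$. The torsion d-tensors of $D$ have, in the adapted basis, the expressions $$h_{\mathcal T}\mathbb T\left(\tfrac{\delta}{\delta t^b},\tfrac{\delta}{\delta t^a}\right)=T^c_{ab}\tfrac{\delta}{\delta t^c},\quad h_M\mathbb T\left(\tfrac{\delta}{\delta t^b},\tfrac{\delta}{\delta t^a}\right)=T^k_{ab}\tfrac{\delta}{\delta x^k},\quad w\mathbb T\left(\tfrac{\delta}{\delta t^b},\tfrac{\delta}{\delta t^a}\right)=T^{(f)}_{(r)ab}\tfrac{\partial}{\partial p^f_r},$$ $$h_{\mathcal T}\mathbb T\left(\tfrac{\delta}{\delta x^j},\tfrac{\delta}{\delta t^a}\right)=T^c_{aj}\tfrac{\delta}{\delta t^c},\quad h_M\mathbb T\left(\tfrac{\delta}{\delta x^j},\tfrac{\delta}{\delta t^a}\right)=T^k_{aj}\tfrac{\delta}{\delta x^k},\quad w\mathbb T\left(\tfrac{\delta}{\delta x^j},\tfrac{\delta}{\delta t^a}\right)=T^{(f)}_{(r)aj}\tfrac{\partial}{\partial p^f_r},$$ $$h_{\mathcal T}\mathbb T\left(\tfrac{\partial}{\partial p^b_j},\tfrac{\delta}{\delta t^a}\right)=P^{c(j)}_{a(b)}\tfrac{\delta}{\delta t^c},\quad h_M\mathbb T\left(\tfrac{\partial}{\partial p^b_j},\tfrac{\delta}{\delta t^a}\right)=P^{k(j)}_{a(b)}\tfrac{\delta}{\delta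 x^k},\quad w\mathbb T\left(\tfrac{\partial}{\partial p^b_j},\tfrac{\delta}{\delta t^a}\right)=P^{(f)\ (j)}_{(r)a(b)}\tfrac{\partial}{\partial p^f_r},$$ $$h_{\mathcal T}\mathbb T\left(\tfrac{\delta}{\delta x^j},\tfrac{\delta}{\delta x^i}\right)=T^c_{ij}\tfrac{\delta}{\delta t^c},\quad h_M\mathbb T\left(\tfrac{\delta}{\delta x^j},\tfrac{\delta}{\delta x^i}\right)=T^k_{ij}\tfrac{\delta}{\delta x^k},\quad w\mathbb T\left(\tfrac{\delta}{\delta x^j},\tfrac{\delta}{\delta x^i}\right)=T^{(f)}_{(r)ij}\tfrac{\partial}{\partial p^f_r},$$ $$h_{\mathcal T}\mathbb T\left(\tfrac{\partial}{\partial p^b_j},\tfrac{\delta}{\delta x^i}\right)=P^{c(j)}_{i(b)}\tfrac{\delta}{\delta t^c},\quad h_M\mathbb T\left(\tfrac{\partial}{\partial p^b_j},\tfrac{\delta}{\delta x^i}\right)=P^{k(j)}_{i(b)}\tfrac{\delta}{\delta x^k},\quad w\mathbb T\left(\tfrac{\partial}{\partial p^b_j},\tfrac{\delta}{\delta x^i}\right)=P^{(f)\ (j)}_{(r)i(b)}\tfrac{\partial}{\partial p^f_r},$$ $$h_{\mathcal T}\mathbb T\left(\tfrac{\partial}{\partial p^b_j},\tfrac{\partial}{\partial p^a_i}\right)=S^{c(i)(j)}_{\ (a)(b)}\tfrac{\delta}{\delta t^c},\quad h_M\mathbb T\left(\tfrac{\partial}{\partial p^b_j},\tfrac{\partial}{\partial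 p^a_i}\right)=S^{k(i)(j)}_{\ (a)(b)}\tfrac{\delta}{\delta x^k},\quad w\mathbb T\left(\tfrac{\partial}{\partial p^b_j},\tfrac{\partial}{\partial p^a_i}\right)=S^{(f)(i)(j)}_{(r)(a)(b)}\tfrac{\partial}{\partial p^f_r},$$ where $$T^c_{ab}=A^c_{ab}-A^c_{ba},\quad T^k_{ab}=0,\quad T^{(f)}_{(r)ab}=R^{(f)}_{(r)ab},$$ $$T^c_{aj}=H^c_{aj},\quad T^k_{aj}=-A^k_{ja},\quad T^{(f)}_{(r)aj}=R^{(f)}_{(r)aj},$$ $$P^{c(j)}_{a(b)}=C^{c(j)}_{a(b)},\quad P^{k(j)}_{a(b)}=0,\quad P^{(f)\ (j)}_{(r)a(b)}=B^{(f)\ (j)}_{(r)a(b)}+A^{(f)(j)}_{(r)(b)a},$$ $$T^c_{ij}=0,\quad T^k_{ij}=H^k_{ij}-H^k_{ji},\quad T^{(f)}_{(r)ij}=R^{(f)}_{(r)ij},$$ $$P^{c(j)}_{i(b)}=0,\quad P^{k(j)}_{i(b)}=C^{k(j)}_{i(b)},\quad P^{(f)\ (j)}_{(r)i(b)}=B^{(f)\ (j)}_{(r)i(b)}+H^{(f)(j)}_{(r)(b)i},$$ $$S^{c(i)(j)}_{\ (a)(b)}=0,\quad S^{k(i)(j)}_{\ (a)(b)}=0,\quad S^{(f)(i)(j)}_{(r)(a)(b)}=-\left(C^{(f)(i)(j)}_{(r)(a)(b)}-C^{(f)(j)(i)}_{(r)(b)(a)}\right).$$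
   Context: All objects are smooth. $\mathcal T,M$ are manifolds of dimensions $m,n$ with local coordinates $(t^a)$, $(x^i)$. Indices $a,\dots,h$ run over $\{1,\dots,m\}$, indices $i,j,k,l,p,q,r,s$ over $\{1,\dots,n\}$; Einstein summation is used. $E^*=J^{1*}(\mathcal T,M)$ is the dual of the $1$-jet bundle: a vector bundle $\pi^*:E^*\to\mathcal T\times M$ with fibre $\mathbb R^{mn}$ and induced coordinates $(t^a,x^i,p^a_i)$ changing by $\tilde t^a=\tilde t^a(t)$, $\tilde x^i=\tilde x^i(x)$, $\tilde p^a_i=\frac{\partial x^j}{\partial\tilde x^i}\frac{\partial\tilde t^a}{\partial t^b}p^b_j$. A nonlinear connection $N$ is a distribution on $E^*$ complementary to the vertical distribution $\mathcal W=\ker\pi^*{}_*$; locally it is spanned by $\frac{\delta}{\delta t^a}=\frac{\partial}{\partial t^a}-\underset{1}{N}{}^{(b)}_{(j)a}\frac{\partial}{\partial p^b_j}$ and $\frac{\delta}{\delta x^i}=\frac{\partial}{\partial x^i}-\underset{2}{N}{}^{(b)}_{(j)i}\frac{\partial}{\partial p^b_j}$, which together with $\frac{\partial}{\partial p^a_i}$ form the adapted basis. $\mathcal H_{\mathcal T},\mathcal H_M$ are the distributions spanned by $\delta/\delta t^a$ and $\delta/\delta x^i$; $h_{\mathcal T},h_M,w$ are the projections of $TE^*=\mathcal H_{\mathcal T}\oplus\mathcal H_M\oplus\mathcal W$ onto the three summands. Set $$R^{(a)}_{(i)bc}=\frac{\delta\underset{1}{N}{}^{(a)}_{(i)b}}{\delta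 t^c}-\frac{\delta\underset{1}{N}{}^{(a)}_{(i)c}}{\delta t^b},\quad R^{(a)}_{(i)bk}=\frac{\delta\underset{1}{N}{}^{(a)}_{(i)b}}{\delta x^k}-\frac{\delta\underset{2}{N}{}^{(a)}_{(i)k}}{\delta t^b},\quad R^{(a)}_{(i)jk}=\frac{\delta\underset{2}{N}{}^{(a)}_{(i)j}}{\delta x^k}-\frac{\delta\underset{2}{N}{}^{(a)}_{(i)k}}{\delta x^j},$$ $$B^{(a)\ (k)}_{(i)b(c)}=\frac{\partial\underset{1}{N}{}^{(a)}_{(i)b}}{\partial p^c_k},\qquad B^{(a)\ (k)}_{(i)j(c)}=\frac{\partial\underset{2}{N}{}^{(a)}_{(i)j}}{\partial p^c_k}.$$ An $N$-linear connection $D$ is a linear connection on $E^*$ preserving by parallelism $\mathcal H_{\mathcal T},\mathcal H_M,\mathcal W$ (i.e. $D_X$ maps sections of each to sections of the same). Its adapted coefficients $D\Gamma(N)$ are defined by $$D_{\frac{\delta}{\delta t^c}}\tfrac{\delta}{\delta t^b}=A^a_{bc}\tfrac{\delta}{\delta t^a},\ D_{\frac{\delta}{\delta t^c}}\tfrac{\delta}{\delta x^j}=A^i_{jc}\tfrac{\delta}{\delta x^i},\ D_{\frac{\delta}{\delta t^c}}\tfrac{\partial}{\partial p^b_j}=-A^{(a)(j)}_{(i)(b)c}\tfrac{\partial}{\partial p^a_i},$$ $$D_{\frac{\delta}{\delta x^k}}\tfrac{\delta}{\delta t^b}=H^a_{bk}\tfrac{\delta}{\delta t^a},\ D_{\frac{\delta}{\delta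 x^k}}\tfrac{\delta}{\delta x^j}=H^i_{jk}\tfrac{\delta}{\delta x^i},\ D_{\frac{\delta}{\delta x^k}}\tfrac{\partial}{\partial p^b_j}=-H^{(a)(j)}_{(i)(b)k}\tfrac{\partial}{\partial p^a_i},$$ $$D_{\frac{\partial}{\partial p^c_k}}\tfrac{\delta}{\delta t^b}=C^{a(k)}_{b(c)}\tfrac{\delta}{\delta t^a},\ D_{\frac{\partial}{\partial p^c_k}}\tfrac{\delta}{\delta x^j}=C^{i(k)}_{j(c)}\tfrac{\delta}{\delta x^i},\ D_{\frac{\partial}{\partial p^c_k}}\tfrac{\partial}{\partial p^b_j}=-C^{(a)(j)(k)}_{(i)(b)(c)}\tfrac{\partial}{\partial p^a_i}.$$ The torsion is $\mathbb T(X,Y)=D_XY-D_YX-[X,Y]$. *)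

(* Defs.v *)
From mathcomp Require Import all_boot all_order all_algebra.
From mathcomp Require Import all_classical all_reals all_analysis.

Set Implicit Arguments.
Unset Strict Implicit.
Unset Printing Implicit Defensive.

Import Order.TTheory GRing.Theory Num.Theory.
Import numFieldNormedType.Exports.

Local Open Scope classical_set_scope.
Local Open Scope ring_scope.

Section Smooth.
Context {R : realType} {V : normedModType R}.

(* Only used with V finite dimensional and O open, where it is the usual C^k
   (for k > 0, the total derivative and all directional derivatives exist, and
   the latter are C^(k-1)). *)
Fixpoint Ck (k : nat) (O : set V) (f : V -> R) : Prop :=
  if k is k'.+1 then
    (forall x, O x -> differentiable f x) /\ (forall v, Ck k' O ('D_v f))
  else forall x, O x -> {for x, continuous f}.

Definition smooth (O : set V) (f : V -> R) : Prop := forall k, Ck k O f.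

End Smooth.

Section Manifold.
Context {R : realType}.

(* A homeomorphism from the open set cdom onto an open set of R^m; only the
   values of cmap on cdom and of cinv on cmap @` cdom are meaningful. *)
Record chart (S : topologicalType) (m : nat) := Chart {
  cdom : set S;
  cmap : S -> 'rV[R]_m;
  cinv : 'rV[R]_m -> S;
  cdom_open : open cdom;
  ccod_open : open (cmap @` cdom);
  cmapK : forall s, cdom s -> cinv (cmap s) = s;
  cmap_continuous : forall s, cdom s -> {for s, continuous cmap};
  cinv_continuous : forall x, (cmap @` cdom) x -> {for x, continuous cinv}
}.

Record manifold (m : nat) := Manifold {
  mpoint :> topologicalType;
  mhausdorff : hausdorff_space mpoint;
  msecond_countable : @second_countable mpoint;
  atlas : set (chart mpoint m);
  atlas_cover : forall s, exists2 c, atlas c & cdom c s;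
  atlas_compat : forall c c', atlas c -> atlas c' -> forall a : 'I_m,
    smooth (cmap c @` (cdom c `&` cdom c')) (fun x => cmap c' (cinv c x) 0 a)
}.

(* The entry d x~^a / d x^b, at the point s, of the Jacobian matrix of the
   change from the coordinates x of the chart c to the coordinates x~ of c'. *)
Definition jac (m : nat) (S : manifold m) (c c' : chart S m) (s : S)
    (a b : 'I_m) : R :=
  'D_(delta_mx 0 b) (fun x => cmap c' (cinv c x) 0 a) (cmap c s).

End Manifold.

Arguments chart : clear implicits.
Arguments manifold : clear implicits.

(* The dual 1-jet bundle of (T, M), given by its points, its projection onto
   T * M and its induced fibre coordinates p^a_i = fib c d u a i over a chart c
   of T and a chart d of M.  The map fiber_pt c d t x is the inverse of fib c d
   on the fibre over (t, x).  The law fib_change determines the bundle up to a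
   unique isomorphism. *)
Record dual_jet_bundle (R : realType) (m n : nat)
    (T : manifold R m) (M : manifold R n) := DualJetBundle {
  jpoint :> Type;
  jproj : jpoint -> T * M;
  fib : chart R T m -> chart R M n -> jpoint -> 'M[R]_(m, n);
  fiber_pt : chart R T m -> chart R M n -> T -> M -> 'M[R]_(m, n) -> jpoint;
  jproj_fiber_pt : forall c d, atlas c -> atlas d ->
    forall t x p, cdom c t -> cdom d x -> jproj (fiber_pt c d t x p) = (t, x);
  fiber_ptK : forall c d, atlas c -> atlas d ->
    forall t x p, cdom c t -> cdom d x -> fib c d (fiber_pt c d t x p) = p;
  fibK : forall c d, atlas c -> atlas d ->
    forall u, cdom c (jproj u).1 -> cdom d (jproj u).2 ->
    fiber_pt c d (jproj u).1 (jproj u).2 (fib c d u) = u;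
  fib_change : forall c c' d d', atlas c -> atlas c' -> atlas d -> atlas d' ->
    forall u, cdom c (jproj u).1 -> cdom c' (jproj u).1 ->
      cdom d (jproj u).2 -> cdom d' (jproj u).2 ->
    forall a i, fib c' d' u a i =
      \sum_(j < n) \sum_(b < m)
        jac d' d (jproj u).2 j i * jac c c' (jproj u).1 a b * fib c d u b j
}.

Section DualJet.
Context {R : realType} {m n : nat} {T : manifold R m} {M : manifold R n}.
Variable E : dual_jet_bundle T M.

Local Notation model := ('rV[R]_m * 'rV[R]_n * 'M[R]_(m, n))%type.
Local Notation chartT := (chart R T m).
Local Notation chartM := (chart R M n).

Definition jdom (c : chartT) (d : chartM) : set E :=
  [set u | cdom c (jproj u).1 /\ cdom d (jproj u).2].

Definition jcoord (c : chartT) (d : chartM) (u : E) : model :=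
  (cmap c (jproj u).1, cmap d (jproj u).2, fib c d u).

Definition jinv (c : chartT) (d : chartM) (y : model) : E :=
  fiber_pt E c d (cinv c y.1.1) (cinv d y.1.2) y.2.

Definition jopen (W : set E) : Prop :=
  forall c d, atlas c -> atlas d -> open (jcoord c d @` (W `&` jdom c d)).

Definition jsmooth (W : set E) (f : E -> R) : Prop :=
  forall c d, atlas c -> atlas d ->
    smooth (jcoord c d @` (W `&` jdom c d)) (f \o jinv c d).

Definition smooth_at (u : E) (f : E -> R) : Prop :=
  exists W, [/\ jopen W, W u & jsmooth W f].

(* Tangent vectors at u are the derivations at u of the germs of smooth
   functions; they are extended by 0 to the functions that are not smooth near
   u, so that equality of tangent vectors is equality of operators. *)
Definition tvector : Type := (E -> R) -> R.

Record tangent (u : E) (v : tvector) : Prop := {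
  tangent_out : forall f, ~ smooth_at u f -> v f = 0;
  tangent_germ : forall f g, smooth_at u f ->
    (exists W, [/\ jopen W, W u & {in W, f =1 g}]) -> v f = v g;
  tangent_linear : forall (k : R) f g, smooth_at u f -> smooth_at u g ->
    v (fun w => k * f w + g w) = k * v f + v g;
  tangent_leibniz : forall f g, smooth_at u f -> smooth_at u g ->
    v (fun w => f w * g w) = f u * v g + g u * v f
}.

(* Vector fields are total; the predicates below restrict them to open sets. *)
Definition vfield : Type := E -> tvector.

Definition vapply (X : vfield) (f : E -> R) : E -> R := fun u => X u f.

Definition vscale (f : E -> R) (X : vfield) : vfield := fun u => f u *: X u.

Definition smooth_vfield (W : set E) (X : vfield) : Prop :=
  (forall u, W u -> tangent u (X u)) /\
  (forall W' f, jopen W' -> W' `<=` W -> jsmooth W' f ->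
    jsmooth W' (vapply X f)).

Definition lie (X Y : vfield) : vfield := fun u f =>
  if `[< smooth_at u f >] then X u (vapply Y f) - Y u (vapply X f) else 0.

Definition dcoord (c : chartT) (d : chartM) (e : model) : vfield := fun u f =>
  if `[< smooth_at u f >] then 'D_e (f \o jinv c d) (jcoord c d u) else 0.

Definition dt c d (a : 'I_m) : vfield := dcoord c d (delta_mx 0 a, 0, 0).
Definition dx c d (i : 'I_n) : vfield := dcoord c d (0, delta_mx 0 i, 0).
(* dp c d a i is the field d / d p^a_i. *)
Definition dp c d (a : 'I_m) (i : 'I_n) : vfield :=
  dcoord c d (0, 0, delta_mx a i).

(* The kernel of the differential of jproj.  Since jproj is a submersion,
   f \o jproj is smooth near u exactly when f is smooth near jproj u; when it
   is not, v (f \o jproj) is 0 anyway. *)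
Definition vert (u : E) : set tvector :=
  [set v | tangent u v /\ forall f : T * M -> R, v (fun w : E => f (jproj w)) = 0].

Definition delta_t c d (N1 : 'I_m -> 'I_n -> 'I_m -> E -> R) (a : 'I_m)
    : vfield :=
  dt c d a - \sum_(b < m) \sum_(j < n) vscale (N1 b j a) (dp c d b j).

Definition delta_x c d (N2 : 'I_m -> 'I_n -> 'I_n -> E -> R) (i : 'I_n)
    : vfield :=
  dx c d i - \sum_(b < m) \sum_(j < n) vscale (N2 b j i) (dp c d b j).

(* A nonlinear connection is the distribution hor.  Its coefficients
   N1 c d b j a = N_1^(b)_(j)a and N2 c d b j i = N_2^(b)_(j)i in the chart
   (c, d) are uniquely determined on jdom c d by hor. *)
Record nonlinear_connection := NonlinearConnection {
  hor : E -> set tvector;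
  N1 : chartT -> chartM -> 'I_m -> 'I_n -> 'I_m -> E -> R;
  N2 : chartT -> chartM -> 'I_m -> 'I_n -> 'I_n -> E -> R;
  hor_vert_sum : forall u v, tangent u v ->
    exists h w, [/\ hor u h, vert u w & v = h + w];
  hor_vert_direct : forall u v, hor u v -> vert u v -> v = 0;
  N1_smooth : forall c d, atlas c -> atlas d ->
    forall b j a, jsmooth (jdom c d) (N1 c d b j a);
  N2_smooth : forall c d, atlas c -> atlas d ->
    forall b j i, jsmooth (jdom c d) (N2 c d b j i);
  hor_span : forall c d, atlas c -> atlas d -> forall u, jdom c d u ->
    hor u = [set v | exists (l : 'I_m -> R) (k : 'I_n -> R),
      v = \sum_a l a *: delta_t c d (N1 c d) a u
        + \sum_i k i *: delta_x c d (N2 c d) i u]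
}.

Section Nonlinear.
Variable N : nonlinear_connection.

Definition del_t c d : 'I_m -> vfield := delta_t c d (N1 N c d).
Definition del_x c d : 'I_n -> vfield := delta_x c d (N2 N c d).

(* The spans below do not depend on the chart around u. *)
Definition HT (u : E) : set tvector :=
  [set v | exists c d, [/\ atlas c, atlas d, jdom c d u &
    exists l : 'I_m -> R, v = \sum_a l a *: del_t c d a u]].

Definition HM (u : E) : set tvector :=
  [set v | exists c d, [/\ atlas c, atlas d, jdom c d u &
    exists k : 'I_n -> R, v = \sum_i k i *: del_x c d i u]].

Definition decomp (u : E) (v vT vM vW : tvector) : Prop :=
  [/\ HT u vT, HM u vM, vert u vW & v = vT + vM + vW].

Definition hT (X : vfield) : vfield := fun u =>
  xget 0 [set vT | exists vM vW, decomp u (X u) vT vM vW].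
Definition hM (X : vfield) : vfield := fun u =>
  xget 0 [set vM | exists vT vW, decomp u (X u) vT vM vW].
Definition wV (X : vfield) : vfield := fun u =>
  xget 0 [set vW | exists vT vM, decomp u (X u) vT vM vW].

(* R_tt a i b e = R^(a)_(i)be,  R_tx a i b k = R^(a)_(i)bk,
   R_xx a i j k = R^(a)_(i)jk,
   Bt a i b e k = B^(a)(k)_(i)b(e),  Bx a i j e k = B^(a)(k)_(i)j(e). *)
Definition R_tt c d (a : 'I_m) (i : 'I_n) (b e : 'I_m) (u : E) : R :=
  del_t c d e u (N1 N c d a i b) - del_t c d b u (N1 N c d a i e).
Definition R_tx c d (a : 'I_m) (i : 'I_n) (b : 'I_m) (k : 'I_n) (u : E) : R :=
  del_x c d k u (N1 N c d a i b) - del_t c d b u (N2 N c d a i k).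
Definition R_xx c d (a : 'I_m) (i : 'I_n) (j k : 'I_n) (u : E) : R :=
  del_x c d k u (N2 N c d a i j) - del_x c d j u (N2 N c d a i k).
Definition Bt c d (a : 'I_m) (i : 'I_n) (b : 'I_m) (e : 'I_m) (k : 'I_n)
    (u : E) : R :=
  dp c d e k u (N1 N c d a i b).
Definition Bx c d (a : 'I_m) (i : 'I_n) (j : 'I_n) (e : 'I_m) (k : 'I_n)
    (u : E) : R :=
  dp c d e k u (N2 N c d a i j).

End Nonlinear.

(* A linear connection is a family, compatible with restriction, of covariant
   derivatives on the smooth vector fields over the open sets W; nabla X Y is
   meaningful on the open sets where X and Y are smooth. *)
Record linear_connection := LinearConnection {
  nabla :> vfield -> vfield -> vfield;
  nabla_smooth : forall W X Y, jopen W ->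
    smooth_vfield W X -> smooth_vfield W Y -> smooth_vfield W (nabla X Y);
  nabla_local : forall W X X' Y Y', jopen W ->
    smooth_vfield W X -> smooth_vfield W Y ->
    {in W, X =1 X'} -> {in W, Y =1 Y'} -> {in W, nabla X Y =1 nabla X' Y'};
  nablaDl : forall W X X' Y, jopen W ->
    smooth_vfield W X -> smooth_vfield W X' -> smooth_vfield W Y ->
    {in W, nabla (X + X') Y =1 nabla X Y + nabla X' Y};
  nablaZl : forall W f X Y, jopen W -> jsmooth W f ->
    smooth_vfield W X -> smooth_vfield W Y ->
    {in W, nabla (vscale f X) Y =1 vscale f (nabla X Y)};
  nablaDr : forall W X Y Y', jopen W ->
    smooth_vfield W X -> smooth_vfield W Y -> smooth_vfield W Y' ->
    {in W, nabla X (Y + Y') =1 nabla X Y + nabla X Y'};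
  nablaZr : forall W f X Y, jopen W -> jsmooth W f ->
    smooth_vfield W X -> smooth_vfield W Y ->
    {in W, nabla X (vscale f Y) =1
           vscale (vapply X f) Y + vscale f (nabla X Y)}
}.

Definition torsion (D : linear_connection) (X Y : vfield) : vfield :=
  D X Y - D Y X - lie X Y.

Definition preserves (D : linear_connection) (H : E -> set tvector) : Prop :=
  forall W X Y, jopen W -> smooth_vfield W X -> smooth_vfield W Y ->
    (forall u, W u -> H u (Y u)) -> forall u, W u -> H u (D X Y u).

Definition N_linear (N : nonlinear_connection) (D : linear_connection) : Prop :=
  [/\ preserves D (HT N), preserves D (HM N) & preserves D vert].

(* Each pair (a)(i) or (b)(j) of indices attached to a p-direction is given as
   two consecutive arguments a i or b j:
     At a b e = A^a_be,  Ax i j e = A^i_je,  Ap a i b j e = A^(a)(j)_(i)(b)e,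
     Ht a b k = H^a_bk,  Hx i j k = H^i_jk,  Hp a i b j k = H^(a)(j)_(i)(b)k,
     Ct a b e k = C^a(k)_b(e),  Cx i j e k = C^i(k)_j(e),
     Cp a i b j e k = C^(a)(j)(k)_(i)(b)(e). *)
Record coefficients := Coefficients {
  At : 'I_m -> 'I_m -> 'I_m -> E -> R;
  Ax : 'I_n -> 'I_n -> 'I_m -> E -> R;
  Ap : 'I_m -> 'I_n -> 'I_m -> 'I_n -> 'I_m -> E -> R;
  Ht : 'I_m -> 'I_m -> 'I_n -> E -> R;
  Hx : 'I_n -> 'I_n -> 'I_n -> E -> R;
  Hp : 'I_m -> 'I_n -> 'I_m -> 'I_n -> 'I_n -> E -> R;
  Ct : 'I_m -> 'I_m -> 'I_m -> 'I_n -> E -> R;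
  Cx : 'I_n -> 'I_n -> 'I_m -> 'I_n -> E -> R;
  Cp : 'I_m -> 'I_n -> 'I_m -> 'I_n -> 'I_m -> 'I_n -> E -> R
}.

Definition adapted_coefficients (N : nonlinear_connection)
    (D : linear_connection) (c : chartT) (d : chartM) (G : coefficients)
    : Prop :=
  forall u, jdom c d u ->
  let dt := del_t N c d in let dx := del_x N c d in let dp := dp c d in
  [/\ [/\ forall b e, D (dt e) (dt b) u = \sum_a At G a b e u *: dt a u,
          forall j e, D (dt e) (dx j) u = \sum_i Ax G i j e u *: dx i u &
          forall b j e, D (dt e) (dp b j) u =
            - \sum_a \sum_i Ap G a i b j e u *: dp a i u],
      [/\ forall b k, D (dx k) (dt b) u = \sum_a Ht G a b k u *: dt a u,
          forall j k, D (dx k) (dx j) u = \sum_i Hx G i j k u *: dx i u &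
          forall b j k, D (dx k) (dp b j) u =
            - \sum_a \sum_i Hp G a i b j k u *: dp a i u] &
      [/\ forall b e k, D (dp e k) (dt b) u =
            \sum_a Ct G a b e k u *: dt a u,
          forall j e k, D (dp e k) (dx j) u =
            \sum_i Cx G i j e k u *: dx i u &
          forall b j e k, D (dp e k) (dp b j) u =
            - \sum_a \sum_i Cp G a i b j e k u *: dp a i u]].

End DualJet.

(* Main.v *)
Require Import Defs.
From HB Require Import structures.
From mathcomp Require Import all_boot all_order all_algebra.
From mathcomp Require Import all_classical all_reals all_analysis.
From mathcomp Require Import ring.

Set Implicit Arguments.
Unset Strict Implicit.
Unset Printing Implicit Defensive.

Import Order.TTheory GRing.Theory Num.Theory.
Import numFieldNormedType.Exports.

Local Open Scope classical_set_scope.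
Local Open Scope ring_scope.

(** The torsion of [D] at [u] is [D X Y u - D Y X u - lie X Y u], and the first
    two terms are read off from the adapted coefficients.  Two facts remain: the
    value of the bracket of two fields of the adapted basis, and the statement
    that a vector written in the adapted basis is split by the projections in
    the obvious way.

    Bracket ([lie_frame_field]).  In a chart every field of the adapted basis is
    a constant coordinate field [D_e] minus a combination, with smooth
    coefficients, of the fields d/dp ([frame_field]).  At [u] such a field is
    the directional derivative along one vector [xi] of the model space, so in
    the commutator of two of them along [xi] and [eta] the second order part is
    [D_xi D_eta f - D_eta D_xi f], which vanishes by the symmetry of second
    derivatives ([derive_sym]).  What is left comes from differentiating the
    coefficients and is vertical; for the coefficients of the nonlinear
    connection these derivatives are by definition the functions R and B.

    Splitting ([decomp_expansion], [decomp_projections]).  The spans defining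
    the two horizontal distributions may be taken in any chart around [u].
    Vertical vectors kill all functions that factor through the projection; the
    fields [del_t] kill the functions pulled back from [M], and the fields [del_x]
    those pulled back from [T], whatever the chart.  Hence evaluating a vector on
    the coordinate functions [t^a] and [x^i] of one fixed chart recovers its
    components, and the decomposition is unique.

    Both facts use that smoothness near a point of the jet bundle, which refers
    to all charts, can be tested in a single one ([smooth_atP]).  This rests on a
    chain rule for smooth functions ([Ck_comp]) and on the smoothness of the
    changes of jet coordinates, whose fibre part has first derivatives of the
    base changes as coefficients ([smooth_jcoord_transition]). *)

(** * Differential calculus of smooth functions *)

Lemma open_near (S : topologicalType) (O : set S) x :
  open O -> O x -> \forall y \near x, O y.
Proof. by move=> oO Ox; apply: open_nbhs_nbhs. Qed.

Section Differentiable.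
Context {R : realType} {V : normedModType R}.
Implicit Types (f g : V -> R) (x v : V) (O : set V).

(** Applied to the difference of two functions, this makes differentiability and
    directional derivatives local notions. *)
Lemma diff_near0 f x : (\forall y \near x, f y = 0) ->
  differentiable f x /\ 'd f x = 0 :> (V -> R).
Proof.
move=> f0.
have fx0 : f x = 0 by apply: nbhs_singleton f0.
have z0 : continuous (\0 : V -> R) by move=> y; exact: cvg_cst.
have ex : f \o shift x = cst (f x) + (\0 : V -> R) +o_ 0 id.
  apply/eqaddoP => e e0; rewrite fx0.
  have f0' : \forall y \near (0 : V), f (y + x) = 0.
    have c : continuous (shift x : V -> V).
      by move=> y; apply: continuousD; [exact: cvg_id|exact: cvg_cst].
    by move: (c 0); rewrite /continuous_at /shift /= add0r => cx; exact: (cx _ f0).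
  near=> y.
  have -> : (f \o shift x - (cst 0 + (\0 : V -> R))) y = 0.
    rewrite !fctE /= (near f0' y) ?subr0 ?addr0 ?subrr //.
  by rewrite normr0 mulr_ge0 // ltW.
have d := diff_unique z0 ex.
split; last by rewrite d.
by apply/diff_locallyP; rewrite d.
Unshelve. all: by end_near.
Qed.

Lemma differentiable_near f g x : (\forall y \near x, f y = g y) ->
  differentiable f x -> differentiable g x.
Proof.
move=> fg df.
have [d0 _] : differentiable (g - f) x /\ 'd (g - f) x = 0 :> (V -> R).
  apply: diff_near0; near=> y; rewrite !fctE.
  by rewrite (near fg y) ?subrr.
by rewrite -(subrK f g); exact: differentiableD.
Unshelve. all: by end_near.
Qed.

Lemma derive_near f g x v : (\forall y \near x, f y = g y) ->
  differentiable f x -> 'D_v f x = 'D_v g x.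
Proof.
move=> fg df.
have [d0 e0] : differentiable (g - f) x /\ 'd (g - f) x = 0 :> (V -> R).
  apply: diff_near0; near=> y; rewrite !fctE.
  by rewrite (near fg y) ?subrr.
rewrite -[in RHS](subrK f g) deriveD; try exact: diff_derivable.
by rewrite [X in _ = X + _]deriveE // e0 add0r.
Unshelve. all: by end_near.
Qed.

End Differentiable.

Section Ck_theory.
Context {R : realType} {V : normedModType R}.
Implicit Types (f g : V -> R) (x v : V) (O : set V) (k : nat).

Lemma Ck_succ k O f : Ck k.+1 O f -> Ck k O f.
Proof.
elim: k f => [|k IH] f [df Df]; first by move=> x Ox; exact/differentiable_continuous/df.
by split=> // v; exact/IH/Df.
Qed.

Lemma Ck_sub k O O' f : O' `<=` O -> Ck k O f -> Ck k O' f.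
Proof.
move=> OO; elim: k f => [|k IH] f /=; first by move=> cf x /OO; exact: cf.
by move=> [df Df]; split=> [x /OO|v]; [exact: df|exact/IH/Df].
Qed.

Lemma Ck_eq k O f g : open O -> (forall x, O x -> f x = g x) ->
  Ck k O f -> Ck k O g.
Proof.
move=> oO; elim: k f g => [|k IH] f g fg.
  move=> cf x Ox; rewrite /prop_for /continuous_at -fg //.
  apply: cvg_trans (cf _ Ox); apply: near_eq_cvg.
  by apply: filterS (open_near oO Ox) => y /fg ->.
move=> [df Df].
have nfg x : O x -> \forall y \near x, f y = g y.
  by move=> Ox; apply: filterS (open_near oO Ox) => y /fg.
split=> [x Ox|v]; first by apply: differentiable_near (df _ Ox); exact: nfg.
apply: IH (Df v) => x Ox; apply: derive_near (df _ Ox); exact: nfg.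
Qed.

Lemma Ck_cst k O (a : R) : Ck k O (cst a).
Proof.
elim: k a => [|k IH] a; first by move=> x _; exact: cvg_cst.
split=> [x _|v]; first exact: differentiable_cst.
have -> : 'D_v (cst a) = cst 0 :> (V -> R); last exact: IH.
by apply/funext => x; exact: derive_cst.
Qed.

Lemma differentiable_linear (l : V -> R) x : linear l -> continuous l ->
  differentiable l x.
Proof.
move=> ll cl; pose lM := GRing.isLinear.Build _ _ _ _ l ll.
pose L : {linear V -> R} := HB.pack l lM.
exact: (@linear_differentiable _ _ _ L).
Qed.

Lemma derive_linear (l : V -> R) x v : linear l -> continuous l ->
  'D_v l x = l v.
Proof.
move=> ll cl; rewrite deriveE; last exact: differentiable_linear.
pose lM := GRing.isLinear.Build _ _ _ _ l ll.
pose L : {linear V -> R} := HB.pack l lM.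
by rewrite (@diff_lin _ _ _ L).
Qed.

Lemma Ck_linear k O (l : V -> R) : linear l -> continuous l -> Ck k O l.
Proof.
move=> ll cl; case: k => [|k]; first by move=> x _; exact: cl.
split=> [x _|v]; first exact: differentiable_linear.
have -> : 'D_v l = cst (l v) :> (V -> R); last exact: Ck_cst.
by apply/funext => x; exact: derive_linear.
Qed.

Lemma Ck_add k O f g : open O -> Ck k O f -> Ck k O g ->
  Ck k O (fun x => f x + g x).
Proof.
move=> oO; elim: k f g => [|k IH] f g.
  by move=> cf cg x Ox; apply: continuousD; [exact: cf|exact: cg].
move=> [df Df] [dg Dg]; split=> [x Ox|v].
  by apply: differentiableD; [exact: df|exact: dg].
apply: Ck_eq (IH _ _ (Df v) (Dg v)) => // x Ox.
by rewrite -deriveD //; apply: diff_derivable; [exact: df|exact: dg].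
Qed.

Lemma Ck_mul k O f g : open O -> Ck k O f -> Ck k O g ->
  Ck k O (fun x => f x * g x).
Proof.
move=> oO; elim: k f g => [|k IH] f g.
  by move=> cf cg x Ox; apply: continuousM; [exact: cf|exact: cg].
move=> Cf Cg; have [cf cg] := (Ck_succ Cf, Ck_succ Cg).
case: Cf Cg => [df Df] [dg Dg]; split=> [x Ox|v].
  by apply: differentiableM; [exact: df|exact: dg].
have := Ck_add oO (IH _ _ cf (Dg v)) (IH _ _ cg (Df v)).
apply: Ck_eq => // x Ox.
by rewrite (@deriveM _ _ f g) //; apply: diff_derivable; [exact: df|exact: dg].
Qed.

Lemma Ck_sum k O (I : Type) (r : seq I) (F : I -> V -> R) : open O ->
  (forall i, Ck k O (F i)) -> Ck k O (fun x => \sum_(i <- r) F i x).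
Proof.
move=> oO CF; elim: r => [|i r IH].
  by apply: Ck_eq (Ck_cst k O 0) => // x _; rewrite big_nil.
by apply: Ck_eq (Ck_add oO (CF i) IH) => // x _; rewrite big_cons.
Qed.

End Ck_theory.

(** The purpose of such a system is to express a map into [W] by real-valued
    components, to which [Ck] applies. *)
Definition coordinate_system (R : realType) (W : normedModType R) (I : finType)
    (b : I -> W) (l : I -> W -> R) : Prop :=
  forall w, w = \sum_i l i w *: b i.

Section Composition.
Context {R : realType} {V W : normedModType R} {I : finType}.
Context {b : I -> W} {l : I -> W -> R}.
Context (bl : coordinate_system b l).
Implicit Types (phi : V -> W) (g : W -> R).

Lemma coordinate_system_sum phi : phi = (fun x => \sum_i l i (phi x) *: b i).
Proof. by apply/funext => x; exact: bl. Qed.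

Lemma continuous_of_coordinates phi x :
  (forall i, {for x, continuous (fun y => l i (phi y))}) ->
  {for x, continuous phi}.
Proof.
move=> c; rewrite (coordinate_system_sum phi).
apply: cvg_big => [|i _]; first exact: add_continuous.
by apply: cvgZ; [exact: c|exact: cvg_cst].
Qed.

Lemma differentiable_of_coordinates phi x :
  (forall i, differentiable (fun y => l i (phi y)) x) -> differentiable phi x.
Proof.
move=> c; rewrite (coordinate_system_sum phi).
elim: index_enum => [|i r IH].
  rewrite (_ : (fun _ => _) = cst 0); first exact: differentiable_cst.
  by apply/funext => y; rewrite big_nil.
rewrite (_ : (fun _ => _) =
    (fun y => l i (phi y) *: b i) + (fun y => \sum_(j <- r) l j (phi y) *: b j)).
  by apply: differentiableD => //; apply: differentiableZl.
by apply/funext => y; rewrite big_cons.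
Qed.

Lemma diff_of_coordinates phi x v :
  (forall i, differentiable (fun y => l i (phi y)) x) ->
  'd phi x v = \sum_i 'D_v (fun y => l i (phi y)) x *: b i.
Proof.
move=> c.
have H r : differentiable (fun y => \sum_(i <- r) l i (phi y) *: b i) x /\
    'd (fun y => \sum_(i <- r) l i (phi y) *: b i) x v
      = \sum_(i <- r) 'D_v (fun y => l i (phi y)) x *: b i.
  elim: r => [|i r [dr er]].
    rewrite (_ : (fun _ => _) = cst 0); last by apply/funext => y; rewrite big_nil.
    by split; [exact: differentiable_cst|rewrite diff_cst big_nil].
  rewrite (_ : (fun _ => _) =
    (fun y => l i (phi y) *: b i) + (fun y => \sum_(j <- r) l j (phi y) *: b j));
    last by apply/funext => y; rewrite big_cons.
  have di : differentiable (fun y => l i (phi y) *: b i) x.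
    exact: differentiableZl.
  split; first exact: differentiableD.
  rewrite big_cons -er (diffD di dr) /=; congr (_ + _).
  by rewrite (diffZl _ (c i)) (deriveE _ (c i)).
rewrite [in LHS](coordinate_system_sum phi); exact: (H _).2.
Qed.

(** Chain rule: by induction on [k], as the derivative of [g \o phi] along [v] is
    the sum of the products of the derivatives of [g] along the basis with the
    derivatives of the components of [phi] along [v]. *)
Lemma Ck_comp k (O : set V) (O' : set W) phi g : open O ->
  (forall x, O x -> O' (phi x)) ->
  (forall i, Ck k O (fun x => l i (phi x))) -> Ck k O' g -> Ck k O (g \o phi).
Proof.
move=> oO Ophi; elim: k g => [|k IH] g Cl Cg.
  move=> x Ox; apply: continuous_comp; last exact/Cg/Ophi.
  by apply: continuous_of_coordinates => i; exact: Cl.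
have Cl' i := Ck_succ (Cl i).
case: Cg => [dg Dg].
have dl x i : O x -> differentiable (fun y => l i (phi y)) x.
  by move=> Ox; exact: (Cl i).1.
have dphi x : O x -> differentiable phi x.
  by move=> Ox; apply: differentiable_of_coordinates => i; exact: dl.
split=> [x Ox|v].
  by apply: differentiable_comp; [exact: dphi|exact/dg/Ophi].
apply: (@Ck_eq _ _ k O (fun x =>
    \sum_i ('D_(b i) g \o phi) x * 'D_v (fun y => l i (phi y)) x)) => //.
  move=> x Ox; rewrite [in RHS]deriveE; last first.
    by apply: differentiable_comp; [exact: dphi|exact/dg/Ophi].
  rewrite diff_comp /=; [|exact: dphi|exact/dg/Ophi].
  rewrite diff_of_coordinates => [|i]; last exact: dl.
  rewrite linear_sum /=; apply: eq_bigr => i _.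
  by rewrite linearZ /= (deriveE _ (dg _ (Ophi _ Ox))) mulrC.
apply: Ck_sum => // i; apply: Ck_mul => //; first exact: IH Cl' (Dg _).
exact: (Cl i).2.
Qed.

End Composition.

Section Symmetry.
Context {R : realType} {V : normedModType R}.
Implicit Types (g : V -> R) (x y u v : V).

Lemma is_derive_line g y v (s : R) : differentiable g (y + s *: v) ->
  is_derive s 1 (fun r : R => g (y + r *: v)) ('D_v g (y + s *: v)).
Proof.
move=> dg.
have E : (fun h : R => h^-1 *: (((fun r : R => g (y + r *: v)) \o shift s)
      (h *: 1) - g (y + s *: v)))
    = (fun h : R => h^-1 *: ((g \o shift (y + s *: v)) (h *: v) - g (y + s *: v))).
  apply/funext => h /=; congr (_ *: (g _ - _)).
  by rewrite addrCA -scalerDl /GRing.scale /= mulr1.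
have : derivable g (y + s *: v) v by exact: diff_derivable.
rewrite /derivable -E => d.
by apply: DeriveDef => //; rewrite /derive E.
Qed.

(** The mean value theorem, applied in the direction [u] and then in the
    direction [v]. *)
Lemma second_difference (O : set V) g x u v (h : R) : 0 < h -> Ck 2 O g ->
  (forall s t : R, 0 <= s <= h -> 0 <= t <= h -> O (x + s *: u + t *: v)) ->
  exists s t : R, [/\ 0 <= s <= h, 0 <= t <= h &
    g (x + h *: u + h *: v) - g (x + h *: u) - (g (x + h *: v) - g x)
      = 'D_v ('D_u g) (x + s *: u + t *: v) * h * h].
Proof.
move=> h0 [dg Dg] Oh; have [dDu _] := Dg u.
have hh : 0 <= h <= h by rewrite ltW // lexx.
have h00 : 0 <= (0 : R) <= h by rewrite lexx ltW.
have int r : r \in `]0, h[%R -> 0 <= r <= h.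
  by rewrite in_itv /= => /andP[r0 rh]; rewrite !ltW.
have int' r : r \in `[0, h]%R -> 0 <= r <= h by rewrite in_itv.
have Oh' s : 0 <= s <= h -> O (x + s *: u).
  by move=> sh; have := Oh s 0 sh h00; rewrite scale0r addr0.
pose F (s : R) := g ((x + h *: v) + s *: u) - g (x + s *: u).
have dF s : 0 <= s <= h -> is_derive s 1 F
    ('D_u g ((x + h *: v) + s *: u) - 'D_u g (x + s *: u)).
  move=> sh; apply: is_deriveB.
    by apply: is_derive_line; rewrite addrAC; apply/dg/Oh.
  by apply: is_derive_line; apply/dg/Oh'.
have cF : {within `[0, h], continuous F}.
  apply: derivable_within_continuous => r /int' rh.
  exact: (@ex_derive _ _ _ _ _ _ _ (dF r rh)).
have [s /int sh Fs] := MVT h0 (fun r rh => dF r (int r rh)) cF.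
pose P (t : R) := 'D_u g ((x + s *: u) + t *: v).
have dP t : 0 <= t <= h -> is_derive t 1 P ('D_v ('D_u g) ((x + s *: u) + t *: v)).
  by move=> th; apply: is_derive_line; apply/dDu/Oh.
have cP : {within `[0, h], continuous P}.
  apply: derivable_within_continuous => r /int' rh.
  exact: (@ex_derive _ _ _ _ _ _ _ (dP r rh)).
have [t /int th Pt] := MVT h0 (fun r rh => dP r (int r rh)) cP.
exists s, t; split=> //.
move: Fs Pt; rewrite /F /P !scale0r !addr0 !subr0 => Fs Pt.
by rewrite -Pt (addrAC x (h *: u)) Fs (addrAC x (h *: v)).
Qed.

(** The second difference of [g] along [u] and [v] is symmetric in [u] and [v],
    and it is [h ^+ 2] times either mixed derivative at points that tend to [x]
    with [h]; continuity of both mixed derivatives concludes. *)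
Lemma derive_sym (O : set V) g x u v : open O -> O x -> Ck 2 O g ->
  'D_u ('D_v g) x = 'D_v ('D_u g) x.
Proof.
move=> oO Ox Cg.
have cont a b : {for x, continuous ('D_a ('D_b g))}.
  by have [_ /(_ b) [_ /(_ a)]] := Cg; apply.
apply/eqP; rewrite -subr_eq0 -normr_eq0; apply: contraT => ne.
set e := `|_| in ne; have e0 : 0 < e / 2.
  by rewrite divr_gt0 // lt_neqAle eq_sym ne normr_ge0.
have near_cont a b : \forall y \near x,
    `|'D_a ('D_b g) x - 'D_a ('D_b g) y| < e / 2.
  by have /cvgrPdist_lt/(_ _ e0) := cont a b.
have : nbhs x [set y | [/\ O y,
    `|'D_u ('D_v g) x - 'D_u ('D_v g) y| < e / 2 &
    `|'D_v ('D_u g) x - 'D_v ('D_u g) y| < e / 2]].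
  apply: filterS3 (open_near oO Ox) (near_cont u v) (near_cont v u).
  by move=> y Oy yu yv; split.
move=> /nbhs_ballP[r /= r0 br].
(* with this [h] the whole parallelogram with sides [h *: u] and [h *: v] lies
   in the ball of radius [r] around [x] *)
pose h := r / (`|u| + `|v| + 1).
have n1 : 0 < `|u| + `|v| + 1 by rewrite ltr_wpDl // addr_ge0.
have h0 : 0 < h by rewrite divr_gt0.
have near_x a b (s t : R) : `|a| + `|b| = `|u| + `|v| ->
    0 <= s <= h -> 0 <= t <= h -> ball x r (x + s *: a + t *: b).
  move=> ab /andP[s0 sh] /andP[t0 th].
  rewrite -ball_normE /= -addrA opprD addrA subrr sub0r normrN.
  apply: le_lt_trans (ler_normD _ _) _; rewrite !normrZ (ger0_norm s0) (ger0_norm t0).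
  apply: (@le_lt_trans _ _ (h * (`|u| + `|v|))).
    by rewrite -ab mulrDr lerD // ler_wpM2r.
  by rewrite /h mulrAC ltr_pdivrMr // ltr_pM2l // ltrDl.
have [s [t [sh th E1]]] := second_difference h0 Cg
  (fun s t sh th => let: And3 H _ _ := br _ (near_x u v s t erefl sh th) in H).
have [s' [t' [sh' th' E2]]] := second_difference h0 Cg
  (fun s t sh th => let: And3 H _ _ := br _ (near_x v u s t (addrC _ _) sh th) in H).
have [_ _ L1] := br _ (near_x u v s t erefl sh th).
have [_ L2 _] := br _ (near_x v u s' t' (addrC _ _) sh' th').
have cancel (A B z : R) : z = A * h * h -> z = B * h * h -> A = B.
  by move=> -> /(mulIf (lt0r_neq0 h0)) /(mulIf (lt0r_neq0 h0)).
have triangle (p q z k : R) : `|p - z| < k -> `|q - z| < k -> `|q - p| < k + k.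
  by move=> pz qz; rewrite -(subrKA z) (le_lt_trans (ler_normD _ _)) // ltrD // distrC.
have E := cancel _ _ _ E1 (etrans _ E2).
rewrite E in L1; last by rewrite (addrAC x (h *: u)) opprB !addrA; ring.
by have := triangle _ _ _ _ L1 L2; rewrite -/e -splitr ltxx.
Qed.

End Symmetry.

Section Smooth_theory.
Context {R : realType} {V : normedModType R}.
Implicit Types (f g : V -> R) (x v : V) (O : set V).

Lemma smooth_differentiable O f x : smooth O f -> O x -> differentiable f x.
Proof. by move=> /(_ 1) [df _] /df. Qed.

Lemma smooth_derive O f v : smooth O f -> smooth O ('D_v f).
Proof. by move=> sf k; have [_] := sf k.+1; exact. Qed.

Lemma smooth_sub O O' f : O' `<=` O -> smooth O f -> smooth O' f.
Proof. by move=> OO sf k; exact: Ck_sub (sf k). Qed.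

Lemma smooth_eq O f g : open O -> (forall x, O x -> f x = g x) ->
  smooth O f -> smooth O g.
Proof. by move=> oO fg sf k; exact: Ck_eq (sf k). Qed.

Lemma smooth_cst O (a : R) : smooth O (cst a).
Proof. by move=> k; exact: Ck_cst. Qed.

Lemma smooth_add O f g : open O -> smooth O f -> smooth O g ->
  smooth O (fun x => f x + g x).
Proof. by move=> oO sf sg k; exact: Ck_add. Qed.

Lemma smooth_mul O f g : open O -> smooth O f -> smooth O g ->
  smooth O (fun x => f x * g x).
Proof. by move=> oO sf sg k; exact: Ck_mul. Qed.

Lemma smooth_sum O (I : Type) (r : seq I) (F : I -> V -> R) : open O ->
  (forall i, smooth O (F i)) -> smooth O (fun x => \sum_(i <- r) F i x).
Proof. by move=> oO sF k; apply: Ck_sum => // i; exact: sF. Qed.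

Lemma smooth_comp (W : normedModType R) (I : finType) (b : I -> W)
    (l : I -> W -> R) (O : set V) (O' : set W) (phi : V -> W) (g : W -> R) :
  coordinate_system b l -> open O -> (forall x, O x -> O' (phi x)) ->
  (forall i, smooth O (fun x => l i (phi x))) -> smooth O' g ->
  smooth O (g \o phi).
Proof.
by move=> bl oO Ophi sl sg k; apply: (Ck_comp bl) (sg k) => // i; exact: sl.
Qed.

End Smooth_theory.

Section Coordinates.
Context {R : realType} {m n : nat}.
Local Notation model := ('rV[R]_m * 'rV[R]_n * 'M[R]_(m, n))%type.

Lemma modelD (x x' : 'rV[R]_m) (y y' : 'rV[R]_n) (p p' : 'M[R]_(m, n)) :
  (x, y, p) + (x', y', p') = (x + x', y + y', p + p') :> model.
Proof. by []. Qed.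

Lemma modelZ k (x : 'rV[R]_m) (y : 'rV[R]_n) (p : 'M[R]_(m, n)) :
  k *: (x, y, p) = (k *: x, k *: y, k *: p) :> model.
Proof. by []. Qed.

Lemma row_coordinates k : @coordinate_system R 'rV[R]_k 'I_k
  (fun i => delta_mx 0 i) (fun i w => w 0 i).
Proof. by move=> w; exact: row_sum_delta. Qed.

Definition model_basis (i : 'I_m + 'I_n + 'I_m * 'I_n) : model :=
  match i with
  | inl (inl a) => (delta_mx 0 a, 0, 0)
  | inl (inr i) => (0, delta_mx 0 i, 0)
  | inr p => (0, 0, delta_mx p.1 p.2)
  end.

Definition model_coord (i : 'I_m + 'I_n + 'I_m * 'I_n) (y : model) : R :=
  match i with
  | inl (inl a) => y.1.1 0 a
  | inl (inr i) => y.1.2 0 i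
  | inr p => y.2 p.1 p.2
  end.

Lemma smooth_comp_row (V : normedModType R) k (O : set V) (O' : set 'rV[R]_k)
    (phi : V -> 'rV[R]_k) (g : 'rV[R]_k -> R) :
  open O -> (forall x, O x -> O' (phi x)) ->
  (forall i, smooth O (fun x => phi x 0 i)) -> smooth O' g ->
  smooth O (fun x => g (phi x)).
Proof. exact: (smooth_comp (@row_coordinates k)). Qed.

Lemma model_coordinates : coordinate_system model_basis model_coord.
Proof.
have sum_inj (W : lmodType R) (J : finType) (w : J -> W) (c : J -> R)
    (h : W -> model) : h 0 = 0 -> {morph h : x y / x + y} ->
    (forall k x, h (k *: x) = k *: h x) ->
    \sum_j c j *: h (w j) = h (\sum_j c j *: w j).
  move=> h0 hD hZ; rewrite (big_morph h hD h0).
  by apply: eq_bigr => j _; rewrite hZ.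
move=> [[x y] p]; rewrite !big_sumType /=.
rewrite (sum_inj _ _ (fun a => delta_mx 0 a) (fun a => x 0 a)
  (fun v => (v, 0, 0))) //; last 2 first.
- by move=> v w; rewrite modelD !addr0.
- by move=> k v; rewrite modelZ !scaler0.
rewrite (sum_inj _ _ (fun a => delta_mx 0 a) (fun a => y 0 a)
  (fun v => (0, v, 0))) //; last 2 first.
- by move=> v w; rewrite modelD !addr0.
- by move=> k v; rewrite modelZ !scaler0.
rewrite (sum_inj _ _ (fun i => delta_mx i.1 i.2) (fun i => p i.1 i.2)
  (fun v => (0, 0, v))) //; last 2 first.
- by move=> v w; rewrite modelD !addr0.
- by move=> k v; rewrite modelZ !scaler0.
rewrite -!row_sum_delta -(pair_bigA _ (fun i j => p i j *: delta_mx i j)).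
rewrite -matrix_sum_delta.
by rewrite !modelD !addr0 !add0r.
Qed.

Lemma fst_continuous (U W : topologicalType) : continuous (@fst U W).
Proof. by move=> y; exact: cvg_fst. Qed.

Lemma snd_continuous (U W : topologicalType) : continuous (@snd U W).
Proof. by move=> y; exact: cvg_snd. Qed.

Lemma model_coord_continuous i : continuous (model_coord i).
Proof.
case: i => [[a|i]|[a i]] y; rewrite /model_coord.
- apply: (@continuous_comp _ _ _ (fun y : model => y.1.1) (fun v => v 0 a)).
    by apply: (@continuous_comp _ _ _ fst fst); exact: fst_continuous.
  exact: coord_continuous.
- apply: (@continuous_comp _ _ _ (fun y : model => y.1.2) (fun v => v 0 i)).
    apply: (@continuous_comp _ _ _ fst snd).
      exact: fst_continuous.
    exact: snd_continuous.
  exact: coord_continuous.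
apply: (@continuous_comp _ _ _ (fun y : model => y.2) (fun v => v a i)).
  exact: snd_continuous.
exact: coord_continuous.
Qed.

Lemma model_coord_linear i : linear (model_coord i).
Proof. by case: i => [[a|i]|[a i]] k x y /=; rewrite !mxE. Qed.

Lemma smooth_model_coord i (O : set model) : smooth O (model_coord i).
Proof.
move=> k; apply: Ck_linear; first exact: model_coord_linear.
exact: model_coord_continuous.
Qed.

Lemma derive_model_coord i (e y : model) :
  'D_e (model_coord i) y = model_coord i e.
Proof.
apply: derive_linear; first exact: model_coord_linear.
exact: model_coord_continuous.
Qed.

End Coordinates.

(** * Changes of coordinates on the manifolds and on the dual jet bundle *)

Section Charts.
Context {R : realType}.

(** The image is the part of the codomain of the chart on which the continuous
    inverse takes its values in [U]. *)
Lemma chart_image_open (S : topologicalType) k (c : chart R S k) (U : set S) :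
  open U -> open (cmap c @` (cdom c `&` U)).
Proof.
move=> oU; rewrite openE => _ [s [cs Us] <-].
have cc : (cmap c @` cdom c) (cmap c s) by exists s.
have U' : nbhs (cinv c (cmap c s)) U by rewrite cmapK //; exact: open_near.
have ci : \forall x \near cmap c s, U (cinv c x) := cinv_continuous cc U'.
apply: filterS2 (open_near (@ccod_open _ _ _ c) cc) ci.
by move=> _ [t ct <-] /=; rewrite cmapK // => Ut; exists t.
Qed.

Context {k : nat} {S : manifold R k}.
Implicit Types c : chart R S k.

Definition overlap c c' : set 'rV[R]_k := cmap c @` (cdom c `&` cdom c').

Lemma overlap_open c c' : open (overlap c c').
Proof. exact/chart_image_open/cdom_open. Qed.

Lemma overlap_map c c' x : overlap c c' x -> overlap c' c (cmap c' (cinv c x)).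
Proof. by move=> [s [cs c's] <-]; rewrite cmapK //; exists s. Qed.

Lemma smooth_transition c c' a : atlas c -> atlas c' ->
  smooth (overlap c c') (fun x => cmap c' (cinv c x) 0 a).
Proof. by move=> Ac Ac'; exact: atlas_compat. Qed.

Lemma smooth_comp_transition c c' g : atlas c -> atlas c' ->
  smooth (overlap c' c) g ->
  smooth (overlap c c') (fun x => g (cmap c' (cinv c x))).
Proof.
move=> Ac Ac' sg; apply: (smooth_comp_row _ _ _ sg).
- exact: overlap_open.
- by move=> x; exact: overlap_map.
- by move=> i; exact: smooth_transition.
Qed.

Lemma smooth_jac c c' a b : atlas c -> atlas c' ->
  smooth (overlap c c') (fun x => jac c c' (cinv c x) a b).
Proof.
move=> Ac Ac'.
apply: smooth_eq (smooth_derive (delta_mx 0 b) (smooth_transition a Ac Ac')).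
  exact: overlap_open.
by move=> _ [s [cs _] <-]; rewrite /jac cmapK.
Qed.

(** The Jacobian of the inverse change of coordinates, seen as a function of
    the original coordinates. *)
Lemma smooth_jac_inv c c' a b : atlas c -> atlas c' ->
  smooth (overlap c c') (fun x => jac c' c (cinv c x) a b).
Proof.
move=> Ac Ac'.
apply: smooth_eq (smooth_comp_transition Ac Ac' (smooth_jac a b Ac' Ac)).
  exact: overlap_open.
by move=> _ [s [cs c's] <-]; rewrite !cmapK.
Qed.

End Charts.

Section JetCoordinates.
Context {R : realType} {m n : nat} {T : manifold R m} {M : manifold R n}.
Context {E : dual_jet_bundle T M}.
Local Notation model := ('rV[R]_m * 'rV[R]_n * 'M[R]_(m, n))%type.
Implicit Types (c : chart R T m) (d : chart R M n) (u : E) (y : model).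

Lemma smooth_model_comp1 (O : set model) O1 (g : 'rV[R]_m -> R) :
  open O -> (forall y, O y -> O1 y.1.1) -> smooth O1 g ->
  smooth O (fun y => g y.1.1).
Proof.
move=> oO O1y sg; apply: (smooth_comp_row oO O1y _ sg) => i.
exact: (smooth_model_coord (inl (inl i))).
Qed.

Lemma smooth_model_comp2 (O : set model) O2 (g : 'rV[R]_n -> R) :
  open O -> (forall y, O y -> O2 y.1.2) -> smooth O2 g ->
  smooth O (fun y => g y.1.2).
Proof.
move=> oO O2y sg; apply: (smooth_comp_row oO O2y _ sg) => i.
exact: (smooth_model_coord (inl (inr i))).
Qed.

Lemma jcoordK c d u : atlas c -> atlas d -> jdom c d u ->
  jinv E c d (jcoord c d u) = u.
Proof. by move=> Ac Ad [cu du]; rewrite /jinv /= !cmapK // fibK. Qed.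

Lemma jinv_props c d y : atlas c -> atlas d ->
  (cmap c @` cdom c) y.1.1 -> (cmap d @` cdom d) y.1.2 ->
  [/\ jproj (jinv E c d y) = (cinv c y.1.1, cinv d y.1.2),
      jdom c d (jinv E c d y) & jcoord c d (jinv E c d y) = y].
Proof.
case: y => [[x z] p] Ac Ad /= [t ct <-] [s ds <-].
by rewrite /jdom /jcoord /jinv /= !cmapK // jproj_fiber_pt //= fiber_ptK.
Qed.

Definition joverlap c d c' d' : set model :=
  [set y | overlap c c' y.1.1 /\ overlap d d' y.1.2].

Lemma joverlap_open c d c' d' : open (joverlap c d c' d').
Proof.
rewrite openE => y [y1 y2].
have c1 : {for y, continuous (fun y : model => y.1.1)}.
  by apply: continuous_comp; exact: fst_continuous.
have c2 : {for y, continuous (fun y : model => y.1.2)}.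
  by apply: continuous_comp; [exact: fst_continuous|exact: snd_continuous].
have n1 : \forall z \near y, overlap c c' z.1.1 :=
  c1 _ (open_near (overlap_open (c:=c) (c':=c')) y1).
have n2 : \forall z \near y, overlap d d' z.1.2 :=
  c2 _ (open_near (overlap_open (c:=d) (c':=d')) y2).
by apply: filterS2 n1 n2 => z; split.
Qed.

Lemma joverlap_cod c d c' d' y : joverlap c d c' d' y ->
  (cmap c @` cdom c) y.1.1 /\ (cmap d @` cdom d) y.1.2.
Proof. by move=> [[t [ct _] <-] [s [ds _] <-]]; split; [exists t|exists s]. Qed.

Lemma joverlap_jinv c d c' d' y : atlas c -> atlas d -> joverlap c d c' d' y ->
  [/\ jproj (jinv E c d y) = (cinv c y.1.1, cinv d y.1.2),
      jdom c d (jinv E c d y), jdom c' d' (jinv E c d y)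
    & jcoord c d (jinv E c d y) = y].
Proof.
move=> Ac Ad /[dup] /joverlap_cod[y1 y2] [[t [ct c't] tE] [s [ds d's] sE]].
have [pE dE cE] := jinv_props Ac Ad y1 y2.
by split=> //; rewrite /jdom /= pE /= -tE -sE !cmapK.
Qed.

Lemma joverlap_jcoord c d c' d' u : jdom c d u -> jdom c' d' u ->
  joverlap c d c' d' (jcoord c d u).
Proof.
by move=> [cu du] [c'u d'u]; split; [exists (jproj u).1|exists (jproj u).2].
Qed.

Lemma jcoord_transition c d c' d' (y : model) : atlas c -> atlas d ->
  atlas c' -> atlas d' -> joverlap c' d' c d y ->
  jcoord c d (jinv E c' d' y) =
    (cmap c (cinv c' y.1.1), cmap d (cinv d' y.1.2),
     \matrix_(a, i) \sum_(j < n) \sum_(b < m)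
       jac d d' (cinv d' y.1.2) j i * jac c' c (cinv c' y.1.1) a b * y.2 b j).
Proof.
move=> Ac Ad Ac' Ad' yo.
have [pE [c'u d'u] [cu du] yE] := joverlap_jinv Ac' Ad' yo.
rewrite {1}/jcoord pE; congr (_, _); apply/matrixP => a i.
rewrite (fib_change Ac' Ac Ad' Ad) // mxE pE /=.
apply: eq_bigr => j _; apply: eq_bigr => b _; congr (_ * _).
by rewrite -[in RHS]yE.
Qed.

(** The coordinates of [E] change smoothly: the fibre coordinates transform
    with coefficients that are first derivatives of the smooth changes of
    coordinates of the base. *)
Lemma smooth_jcoord_transition c d c' d' i : atlas c -> atlas d ->
  atlas c' -> atlas d' ->
  smooth (joverlap c' d' c d)
    (fun y => model_coord i (jcoord c d (jinv E c' d' y))).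
Proof.
move=> Ac Ad Ac' Ad'.
have oO : open (joverlap c' d' c d) by exact: joverlap_open.
have O1 (y : model) : joverlap c' d' c d y -> overlap c' c y.1.1 by case.
have O2 (y : model) : joverlap c' d' c d y -> overlap d' d y.1.2 by case.
case: i => [[a|i]|[a i]].
- apply: smooth_eq (smooth_model_comp1 oO O1 (smooth_transition a Ac' Ac)) => //.
  by move=> y yo; rewrite jcoord_transition.
- apply: smooth_eq (smooth_model_comp2 oO O2 (smooth_transition i Ad' Ad)) => //.
  by move=> y yo; rewrite jcoord_transition.
apply: (@smooth_eq _ _ _ (fun y : model => \sum_(j < n) \sum_(b < m)
   jac d d' (cinv d' y.1.2) j i * jac c' c (cinv c' y.1.1) a b * y.2 b j)) => //.
  by move=> y yo; rewrite jcoord_transition //= mxE.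
apply: smooth_sum => // j; apply: smooth_sum => // b.
apply: smooth_mul => //; last exact: (smooth_model_coord (inr (b, j))).
apply: smooth_mul => //.
  exact: smooth_model_comp2 oO O2 (smooth_jac_inv j i Ad' Ad).
exact: smooth_model_comp1 oO O1 (smooth_jac a b Ac' Ac).
Qed.

Lemma jcoord_transition_continuous c d c' d' y : atlas c -> atlas d ->
  atlas c' -> atlas d' -> joverlap c' d' c d y ->
  {for y, continuous (fun z => jcoord c d (jinv E c' d' z))}.
Proof.
move=> Ac Ad Ac' Ad' yo; apply: (continuous_of_coordinates model_coordinates) => i.
exact: (smooth_jcoord_transition i Ac Ad Ac' Ad' 0).
Qed.

(** Smoothness near a point can be tested in any one chart: in another chart the
    function is composed with a smooth change of coordinates. *)
Lemma smooth_atP c d u (f : E -> R) : atlas c -> atlas d -> jdom c d u ->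
  smooth_at u f <-> exists U, [/\ open U,
    U `<=` [set y | (cmap c @` cdom c) y.1.1 /\ (cmap d @` cdom d) y.1.2],
    U (jcoord c d u) & smooth U (f \o jinv E c d)].
Proof.
move=> Ac Ad cdu; split=> [[W [oW Wu sf]]|[U [oO Ocod Ou sf]]].
  exists (jcoord c d @` (W `&` jdom c d)); split; [exact: oW| |by exists u|exact: sf].
  by move=> _ [w [_ [cw dw]] <-]; split; [exists (jproj w).1|exists (jproj w).2].
(* the open set of [E] that corresponds to [U] in the chart [(c, d)] *)
pose W : set E := [set w | jdom c d w /\ U (jcoord c d w)].
have imE c' d' : atlas c' -> atlas d' -> jcoord c' d' @` (W `&` jdom c' d') =
    joverlap c' d' c d `&` [set y | U (jcoord c d (jinv E c' d' y))].
  move=> Ac' Ad'; apply/seteqP; split=> [_ [w [[cdw Ow] cdw'] <-]|y [yo Oy]].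
    by split; [exact: joverlap_jcoord|rewrite /= jcoordK].
  have [_ cdy' cdy yE] := joverlap_jinv Ac' Ad' yo.
  by exists (jinv E c' d' y).
have oW : jopen W.
  move=> c' d' Ac' Ad'; rewrite imE // openE => y [yo Oy].
  apply: filterI; first exact: open_near (@joverlap_open _ _ _ _) yo.
  exact: (jcoord_transition_continuous Ac Ad Ac' Ad' yo (open_near oO Oy)).
exists W; split=> // c' d' Ac' Ad'; have := oW c' d' Ac' Ad'; rewrite imE // => oI.
have : smooth (joverlap c' d' c d `&` [set y | U (jcoord c d (jinv E c' d' y))])
    ((f \o jinv E c d) \o (fun y => jcoord c d (jinv E c' d' y))).
  apply: (smooth_comp model_coordinates) sf => // [y [_ Oy]|i]; first exact: Oy.
  by apply: smooth_sub (smooth_jcoord_transition i Ac Ad Ac' Ad') => y [].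
apply: smooth_eq => // y [yo _] /=.
by have [_ _ cdy _] := joverlap_jinv Ac' Ad' yo; rewrite jcoordK.
Qed.

End JetCoordinates.

(** * Tangent vectors in a chart *)

Section TangentVectors.
Context {R : realType} {m n : nat} {T : manifold R m} {M : manifold R n}.
Context {E : dual_jet_bundle T M} {c : chart R T m} {d : chart R M n}.
Context (Ac : atlas c) (Ad : atlas d).
Local Notation model := ('rV[R]_m * 'rV[R]_n * 'M[R]_(m, n))%type.
Implicit Types (u w : E) (f g : E -> R) (y e : model) (U : set model).

Lemma smooth_at_near u f : jdom c d u -> smooth_at u f ->
  \forall y \near jcoord c d u, [/\ smooth_at (jinv E c d y) f,
    jdom c d (jinv E c d y) & jcoord c d (jinv E c d y) = y].
Proof.
move=> cdu /(smooth_atP f Ac Ad cdu)[U [oU Ucod Uu sf]].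
apply: filterS (open_near oU Uu) => y Uy.
have [y1 y2] := Ucod _ Uy.
have [_ cdy yE] := jinv_props (E:=E) Ac Ad y1 y2.
by split=> //; apply/(smooth_atP f Ac Ad cdy); exists U; rewrite yE.
Qed.

Lemma smooth_at_differentiable u f : jdom c d u -> smooth_at u f ->
  differentiable (f \o jinv E c d) (jcoord c d u).
Proof.
move=> cdu /(smooth_atP f Ac Ad cdu)[U [_ _ Uu sf]].
exact: smooth_differentiable sf Uu.
Qed.

Lemma smooth_at_cst u (a : R) : jdom c d u -> smooth_at u (cst a).
Proof.
move=> cdu; apply/(smooth_atP _ Ac Ad cdu); exists (joverlap c d c d).
split; [exact: joverlap_open|exact: joverlap_cod|exact: joverlap_jcoord|].
exact: smooth_cst.
Qed.

Lemma smooth_at2 u f g : jdom c d u -> smooth_at u f -> smooth_at u g ->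
  exists U, [/\ open U,
    U `<=` [set y | (cmap c @` cdom c) y.1.1 /\ (cmap d @` cdom d) y.1.2],
    U (jcoord c d u), smooth U (f \o jinv E c d) & smooth U (g \o jinv E c d)].
Proof.
move=> cdu /(smooth_atP f Ac Ad cdu)[U [oU Ucod Uu sf]].
move=> /(smooth_atP g Ac Ad cdu)[U' [oU' U'cod U'u sg]].
exists (U `&` U'); split; first exact: openI.
- by move=> y [/Ucod].
- by split.
- by apply: smooth_sub sf => y [].
- by apply: smooth_sub sg => y [].
Qed.

Lemma smooth_at_add u f g : jdom c d u -> smooth_at u f -> smooth_at u g ->
  smooth_at u (fun w => f w + g w).
Proof.
move=> cdu sf sg; have [U [oU Ucod Uu sf' sg']] := smooth_at2 cdu sf sg.
by apply/(smooth_atP _ Ac Ad cdu); exists U; split=> //; exact: smooth_add.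
Qed.

Lemma smooth_at_mul u f g : jdom c d u -> smooth_at u f -> smooth_at u g ->
  smooth_at u (fun w => f w * g w).
Proof.
move=> cdu sf sg; have [U [oU Ucod Uu sf' sg']] := smooth_at2 cdu sf sg.
by apply/(smooth_atP _ Ac Ad cdu); exists U; split=> //; exact: smooth_mul.
Qed.

Lemma smooth_at_sum u (I : Type) (r : seq I) (F : I -> E -> R) : jdom c d u ->
  (forall i, smooth_at u (F i)) -> smooth_at u (fun w => \sum_(i <- r) F i w).
Proof.
move=> cdu sF; elim: r => [|i r IH].
  rewrite (_ : (fun _ => _) = cst 0); first exact: smooth_at_cst.
  by apply/funext => w; rewrite big_nil.
rewrite (_ : (fun _ => _) = (fun w => F i w + \sum_(j <- r) F j w)).
  exact: smooth_at_add.
by apply/funext => w; rewrite big_cons.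
Qed.

Lemma jopen_near u (W : set E) : jdom c d u -> jopen W -> W u ->
  \forall y \near jcoord c d u, W (jinv E c d y).
Proof.
move=> cdu oW Wu.
have Wu' : (jcoord c d @` (W `&` jdom c d)) (jcoord c d u) by exists u.
apply: filterS (open_near (oW c d Ac Ad) Wu') => _ [w [Ww cdw] <-].
by rewrite jcoordK.
Qed.

Lemma smooth_at_germ u f g : smooth_at u f ->
  (exists W, [/\ jopen W, W u & {in W, f =1 g}]) ->
  jdom c d u -> smooth_at u g.
Proof.
move=> + [W [oW Wu fg]] cdu; move=> /(smooth_atP f Ac Ad cdu)[U [oU Ucod Uu sf]].
pose U' := jcoord c d @` (W `&` jdom c d).
have oU' : open (U `&` U') by apply: openI => //; exact: oW.
apply/(smooth_atP g Ac Ad cdu); exists (U `&` U'); split=> //.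
- by move=> y [/Ucod].
- by split=> //; exists u.
apply: (@smooth_eq _ _ _ (f \o jinv E c d)) => //.
  move=> _ [_ [w [Ww cdw] <-]] /=.
  by rewrite jcoordK // fg // inE.
by apply: smooth_sub sf => y [].
Qed.

Lemma dcoordE u e f : smooth_at u f ->
  dcoord c d e u f = 'D_e (f \o jinv E c d) (jcoord c d u).
Proof. by rewrite /dcoord; case: asboolP. Qed.

Lemma dcoord_out u e f : ~ smooth_at u f -> dcoord c d e u f = 0.
Proof. by rewrite /dcoord; case: asboolP. Qed.

Lemma tangent_dcoord u e : jdom c d u -> tangent u (dcoord c d e u).
Proof.
move=> cdu; split=> [f|f g sf fg|k f g sf sg|f g sf sg].
- exact: dcoord_out.
- have sg := smooth_at_germ sf fg cdu.
  rewrite !dcoordE //; case: fg => W [oW Wu fg].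
  apply: derive_near; last exact: smooth_at_differentiable.
  by apply: filterS (jopen_near cdu oW Wu) => y Wy; rewrite /= fg // inE.
- have df := smooth_at_differentiable cdu sf.
  have dg := smooth_at_differentiable cdu sg.
  rewrite !dcoordE //; last first.
    by apply: smooth_at_add => //; apply: smooth_at_mul => //; exact: smooth_at_cst.
  rewrite (_ : _ \o _ = k \*: (f \o jinv E c d) + (g \o jinv E c d)) //.
  rewrite deriveD; [|exact/diff_derivable/differentiableZ|exact: diff_derivable].
  by rewrite deriveZ //; exact: diff_derivable.
- have df := smooth_at_differentiable cdu sf.
  have dg := smooth_at_differentiable cdu sg.
  rewrite !dcoordE //; last exact: smooth_at_mul.
  rewrite (_ : _ \o _ = (f \o jinv E c d) * (g \o jinv E c d)) //.
  rewrite deriveM; [|exact: diff_derivable|exact: diff_derivable].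
  by rewrite /= jcoordK.
Qed.

Lemma dcoord_direction u k e e' : jdom c d u ->
  dcoord c d (k *: e + e') u = k *: dcoord c d e u + dcoord c d e' u
    :> tvector E.
Proof.
move=> cdu; apply/funext => f; rewrite !fctE.
have [sf|nf] := pselect (smooth_at u f); last first.
  by rewrite !dcoord_out // scaler0 addr0.
have df := smooth_at_differentiable cdu sf.
by rewrite !dcoordE // !deriveE // linearP.
Qed.

Lemma smooth_at_vapply_dcoord u e f : jdom c d u -> smooth_at u f ->
  smooth_at u (vapply (dcoord c d e) f).
Proof.
move=> cdu /(smooth_atP f Ac Ad cdu)[U [oU Ucod Uu sf]].
apply/(smooth_atP _ Ac Ad cdu); exists U; split=> //.
apply: smooth_eq (smooth_derive e sf) => // y Uy.
have [y1 y2] := Ucod _ Uy.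
have [_ cdy yE] := jinv_props (E:=E) Ac Ad y1 y2.
rewrite /vapply /= dcoordE ?yE //.
by apply/(smooth_atP f Ac Ad cdy); exists U; rewrite yE.
Qed.

(** Near [u] the inner field is differentiation in the chart, so this is the
    symmetry of second derivatives. *)
Lemma dcoord_comm u e e' f : jdom c d u ->
  smooth_at u f ->
  dcoord c d e u (vapply (dcoord c d e') f)
    = dcoord c d e' u (vapply (dcoord c d e) f).
Proof.
move=> cdu sf.
have iter a b : dcoord c d a u (vapply (dcoord c d b) f)
    = 'D_a ('D_b (f \o jinv E c d)) (jcoord c d u).
  have sb := smooth_at_vapply_dcoord b cdu sf.
  rewrite dcoordE //; apply: derive_near; last exact: smooth_at_differentiable.
  apply: filterS (smooth_at_near cdu sf) => y [sy _ yE].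
  by rewrite /vapply /= dcoordE // yE.
have /(smooth_atP f Ac Ad cdu)[U [oU _ Uu sf']] := sf.
by rewrite !iter; exact: derive_sym oU Uu (sf' 2).
Qed.

Section Derivation.
Context (u : E) (v : tvector E) (cdu : jdom c d u) (tv : tangent u v).

Lemma tangent_cst0 : v (cst 0) = 0.
Proof.
have s0 := smooth_at_cst 0 cdu.
have := tangent_linear tv (-1) s0 s0.
rewrite mulN1r addNr => v0; rewrite -[RHS]v0; congr v.
by apply/funext => w; rewrite /= mulr0 addr0.
Qed.

Lemma tangent_add f g : smooth_at u f -> smooth_at u g ->
  v (fun w => f w + g w) = v f + v g.
Proof.
move=> sf sg; rewrite -[v f]mul1r -(tangent_linear tv) //.
by congr v; apply/funext => w; rewrite mul1r.
Qed.

Lemma tangent_sub f g : smooth_at u f -> smooth_at u g ->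
  v (fun w => f w - g w) = v f - v g.
Proof.
move=> sf sg; rewrite addrC -mulN1r -(tangent_linear tv) //.
by congr v; apply/funext => w; rewrite mulN1r addrC.
Qed.

Lemma tangent_sum (I : Type) (r : seq I) (F : I -> E -> R) :
  (forall i, smooth_at u (F i)) ->
  v (fun w => \sum_(i <- r) F i w) = \sum_(i <- r) v (F i).
Proof.
move=> sF; elim: r => [|i r IH].
  by rewrite big_nil -[RHS]tangent_cst0; congr v; apply/funext => w; rewrite big_nil.
rewrite big_cons -IH -tangent_add //; last exact: smooth_at_sum.
by congr v; apply/funext => w; rewrite big_cons.
Qed.

End Derivation.

Lemma tangent_scaleD u (k : R) (v v' : tvector E) : tangent u v ->
  tangent u v' -> tangent u (k *: v + v').
Proof.
move=> tv tv'; split=> [f nf|f g sf fg|a f g sf sg|f g sf sg]; rewrite !fctE.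
- by rewrite (tangent_out tv nf) (tangent_out tv' nf) scaler0 addr0.
- by rewrite (tangent_germ tv sf fg) (tangent_germ tv' sf fg).
- by rewrite (tangent_linear tv) // (tangent_linear tv') // /GRing.scale /=; ring.
- by rewrite (tangent_leibniz tv) // (tangent_leibniz tv') // /GRing.scale /=; ring.
Qed.

Lemma tangent0 u : tangent u (0 : tvector E).
Proof.
have z f : (0 : tvector E) f = 0 by [].
by split=> [f _|f g _ _|a f g _ _|f g _ _]; rewrite !z // !mulr0 addr0.
Qed.

Lemma tangent_lincomb u (I : Type) (r : seq I) (k : I -> R)
    (v : I -> tvector E) : (forall i, tangent u (v i)) ->
  tangent u (\sum_(i <- r) k i *: v i).
Proof.
move=> tv; elim: r => [|i r IH]; first by rewrite big_nil; exact: tangent0.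
by rewrite big_cons; exact: tangent_scaleD.
Qed.

End TangentVectors.

(** * Brackets of adapted fields *)

Section FrameFields.
Context {R : realType} {m n : nat} {T : manifold R m} {M : manifold R n}.
Context {E : dual_jet_bundle T M}.
Local Notation model := ('rV[R]_m * 'rV[R]_n * 'M[R]_(m, n))%type.
Implicit Types (c : chart R T m) (d : chart R M n) (u : E) (e : model).
Implicit Types (phi psi : 'I_m -> 'I_n -> E -> R) (f : E -> R).

(** The common form of the fields of the adapted basis and of the coordinate
    fields; see [del_tE], [del_xE] and [dpE]. *)
Definition frame_field c d e phi : vfield E :=
  dcoord c d e - \sum_(b < m) \sum_(j < n) vscale (phi b j) (dp c d b j).

Lemma frame_field_at c d e phi u :
  frame_field c d e phi u =
    dcoord c d e u - \sum_(b < m) \sum_(j < n) phi b j u *: dp c d b j u.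
Proof.
rewrite /frame_field !fctE fct_sumE; congr (_ - _); apply: eq_bigr => b _.
by rewrite fct_sumE.
Qed.

Lemma frame_field_atE c d e phi u f :
  frame_field c d e phi u f =
    dcoord c d e u f - \sum_(b < m) \sum_(j < n) phi b j u * dp c d b j u f.
Proof.
rewrite frame_field_at !fctE fct_sumE; congr (_ - _); apply: eq_bigr => b _.
by rewrite fct_sumE.
Qed.

Lemma frame_field0 c d e : frame_field c d e (fun _ _ => cst 0) = dcoord c d e.
Proof.
apply/funext => u; rewrite frame_field_at big1 ?subr0 // => b _.
by rewrite big1 // => j _; rewrite scale0r.
Qed.

Lemma del_tE (N : nonlinear_connection E) c d a : del_t N c d a =
  frame_field c d (delta_mx 0 a, 0, 0) (fun b j => N1 N c d b j a).
Proof. by []. Qed.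

Lemma del_xE (N : nonlinear_connection E) c d i : del_x N c d i =
  frame_field c d (0, delta_mx 0 i, 0) (fun b j => N2 N c d b j i).
Proof. by []. Qed.

Lemma dpE c d b j : dp c d b j =
  frame_field c d (0, 0, delta_mx b j) (fun _ _ => cst 0).
Proof. by rewrite frame_field0. Qed.

Context {c : chart R T m} {d : chart R M n} (Ac : atlas c) (Ad : atlas d).

(** A directional derivative is linear in the direction. *)
Lemma frame_field_dcoord e phi u : jdom c d u ->
  exists xi : model, frame_field c d e phi u = dcoord c d xi u.
Proof.
move=> cdu.
pose h e' : tvector E := dcoord c d e' u.
have hZD k e1 e2 : h (k *: e1 + e2) = k *: h e1 + h e2.
  exact: dcoord_direction.
have h0 : h 0 = 0.
  by have := hZD (-1) 0 0; rewrite scaleN1r oppr0 addr0 scaleN1r addNr.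
have hS (I : Type) (r : seq I) (k : I -> R) (w : I -> model) :
    h (\sum_(i <- r) k i *: w i) = \sum_(i <- r) k i *: h (w i).
  elim: r => [|i r IH]; first by rewrite !big_nil.
  by rewrite !big_cons hZD IH.
exists ((-1) *: (\sum_(p : 'I_m * 'I_n) phi p.1 p.2 u *: (0, 0, delta_mx p.1 p.2)) + e).
rewrite -[RHS]/(h _) hZD hS frame_field_at scaleN1r addrC; congr (- _ + _).
by rewrite (pair_bigA _ (fun b j => phi b j u *: dp c d b j u)).
Qed.

Lemma tangent_frame_field e phi u : jdom c d u ->
  tangent u (frame_field c d e phi u).
Proof.
move=> cdu; have [xi ->] := frame_field_dcoord e phi cdu.
exact: tangent_dcoord.
Qed.

(** The Leibniz rule produces the last sum; in the other terms the coordinate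
    derivatives are exchanged, which moves the second field to the outside. *)
Lemma frame_field_iter (xi : model) e' psi u f : jdom c d u ->
  (forall b j, smooth_at u (psi b j)) -> smooth_at u f ->
  dcoord c d xi u (vapply (frame_field c d e' psi) f) =
    frame_field c d e' psi u (vapply (dcoord c d xi) f)
    - \sum_(b < m) \sum_(j < n) dcoord c d xi u (psi b j) * dp c d b j u f.
Proof.
move=> cdu spsi sf.
have tx : tangent u (dcoord c d xi u) by exact: tangent_dcoord.
have sd e1 : smooth_at u (vapply (dcoord c d e1) f).
  exact: smooth_at_vapply_dcoord.
have sterm b j : smooth_at u (fun w => psi b j w * vapply (dp c d b j) f w).
  by apply: (smooth_at_mul Ac Ad) => //; exact: sd.
have -> : vapply (frame_field c d e' psi) f = (fun w => vapply (dcoord c d e') f w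
    - \sum_(b < m) \sum_(j < n) psi b j w * vapply (dp c d b j) f w).
  by apply/funext => w; rewrite /vapply frame_field_atE.
rewrite (tangent_sub tx) //; last first.
  by apply: (smooth_at_sum Ac Ad) => // b; exact: (smooth_at_sum Ac Ad).
rewrite (tangent_sum Ac Ad cdu tx) //; last by move=> b; exact: (smooth_at_sum Ac Ad).
rewrite frame_field_atE (dcoord_comm Ac Ad) // -addrA -opprD -big_split /=.
congr (_ - _); apply: eq_bigr => b _.
rewrite (tangent_sum Ac Ad cdu tx) // -big_split /=; apply: eq_bigr => j _.
have sdp : smooth_at u (vapply (dp c d b j) f) by exact: sd.
have comm : dcoord c d xi u (vapply (dp c d b j) f)
    = dp c d b j u (vapply (dcoord c d xi) f) by exact: (dcoord_comm Ac Ad).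
rewrite (tangent_leibniz tx (spsi b j) sdp) comm.
by rewrite [vapply _ _ _ * _]mulrC.
Qed.

(** The second order terms of the bracket cancel because second derivatives
    commute.  The sign is the one with which the bracket enters the torsion. *)
Lemma lie_frame_field e e' phi psi u : jdom c d u ->
  (forall b j, smooth_at u (phi b j)) -> (forall b j, smooth_at u (psi b j)) ->
  - lie (frame_field c d e phi) (frame_field c d e' psi) u =
    \sum_(b < m) \sum_(j < n)
      (frame_field c d e phi u (psi b j) - frame_field c d e' psi u (phi b j))
        *: dp c d b j u.
Proof.
move=> cdu sphi spsi; apply/funext => f; rewrite !fctE fct_sumE.
under eq_bigr => b _ do rewrite fct_sumE.
rewrite /lie; case: asboolP => sf; last first.
  rewrite oppr0 big1 // => b _; rewrite big1 // => j _.
  by rewrite fctE /dp dcoord_out // scaler0.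
have [xi xiE] := frame_field_dcoord e phi cdu.
have [eta etaE] := frame_field_dcoord e' psi cdu.
rewrite [in X in X - _]xiE [in X in _ - X]etaE !frame_field_iter //.
rewrite xiE etaE (dcoord_comm Ac Ad xi eta cdu sf).
have cancel (p q r : R) : - (p - q - (p - r)) = q - r by ring.
rewrite cancel.
rewrite -sumrB; apply: eq_bigr => b _; rewrite -sumrB; apply: eq_bigr => j _.
by rewrite fctE -mulrBl.
Qed.

End FrameFields.

(** * The splitting of the tangent spaces *)

Section Splitting.
Context {R : realType} {m n : nat} {T : manifold R m} {M : manifold R n}.
Context {E : dual_jet_bundle T M}.
Local Notation model := ('rV[R]_m * 'rV[R]_n * 'M[R]_(m, n))%type.
Implicit Types (c : chart R T m) (d : chart R M n) (u : E) (e : model).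
Implicit Types (phi psi : 'I_m -> 'I_n -> E -> R).

(** A function that factors through the projection is not seen by a coordinate
    field along whose lines it stays constant. *)
Lemma dcoord_jproj c d e u (g : T * M -> R) : atlas c -> atlas d -> jdom c d u ->
  (forall h : R, let y := h *: e + jcoord c d u in
     g (cinv c y.1.1, cinv d y.1.2) = g (jproj u)) ->
  dcoord c d e u (fun w => g (jproj w)) = 0.
Proof.
move=> Ac Ad cdu ge; rewrite /dcoord; case: asboolP => // _.
apply: lim_near_cst => //.
have co : (joverlap c d c d) (jcoord c d u) by exact: joverlap_jcoord.
have ch : {for 0, continuous (fun h : R => h *: e + jcoord c d u)}.
  by apply: continuousD; [exact: scalel_continuous|exact: cvg_cst].
have nh : \forall h \near (0 : R), joverlap c d c d (h *: e + jcoord c d u).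
  apply: ch; rewrite /= scale0r add0r; apply: open_near co.
  exact: joverlap_open.
apply: nbhs_dnbhs; apply: filterS nh => h oh /=.
have [pE _ _ _] := joverlap_jinv (E:=E) Ac Ad oh.
by rewrite pE ge jcoordK // subrr scaler0.
Qed.

Lemma dcoord_tfun c d e u (g : T -> R) : atlas c -> atlas d -> jdom c d u ->
  e.1.1 = 0 -> dcoord c d e u (fun w => g (jproj w).1) = 0.
Proof.
move=> Ac Ad cdu e0; apply: (@dcoord_jproj c d e u (fun z => g z.1)) => // h /=.
by rewrite e0 scaler0 add0r cmapK //; case: cdu.
Qed.

Lemma dcoord_xfun c d e u (g : M -> R) : atlas c -> atlas d -> jdom c d u ->
  e.1.2 = 0 -> dcoord c d e u (fun w => g (jproj w).2) = 0.
Proof.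
move=> Ac Ad cdu e0; apply: (@dcoord_jproj c d e u (fun z => g z.2)) => // h /=.
by rewrite e0 scaler0 add0r cmapK //; case: cdu.
Qed.

Lemma vert_dp c d u b j : atlas c -> atlas d -> jdom c d u ->
  vert u (dp (E:=E) c d b j u).
Proof.
move=> Ac Ad cdu; split; first exact: tangent_dcoord.
move=> g; apply: dcoord_jproj => // h /=.
by rewrite !scaler0 !add0r !cmapK //; [case: (jproj u)|case: cdu|case: cdu].
Qed.

Lemma vert_lincomb u (I : Type) (r : seq I) (k : I -> R) (v : I -> tvector E) :
  (forall i, vert u (v i)) -> vert u (\sum_(i <- r) k i *: v i).
Proof.
move=> vv; split; first by apply: tangent_lincomb => i; case: (vv i).
move=> g; rewrite fct_sumE big1 // => i _.
by rewrite fctE (vv i).2 scaler0.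
Qed.

Definition tcoord c a : E -> R := fun w => cmap c (jproj w).1 0 a.
Definition xcoord d i : E -> R := fun w => cmap d (jproj w).2 0 i.

Context {c : chart R T m} {d : chart R M n} (Ac : atlas c) (Ad : atlas d).
Context {u : E} (cdu : jdom c d u).

Lemma dcoord_jcoord e (i : 'I_m + 'I_n + 'I_m * 'I_n) :
  dcoord c d e u (fun w => model_coord i (jcoord c d w)) = model_coord i e.
Proof.
have oO : open (joverlap c d c d) by exact: joverlap_open.
have co : (joverlap c d c d) (jcoord c d u) by exact: joverlap_jcoord.
have E1 y : joverlap c d c d y ->
    model_coord i y = model_coord i (jcoord c d (jinv E c d y)).
  by move=> oy; have [_ _ _ ->] := joverlap_jinv (E:=E) Ac Ad oy.
have si := smooth_model_coord i (joverlap c d c d).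
rewrite dcoordE; last first.
  apply/(smooth_atP _ Ac Ad cdu); exists (joverlap c d c d); split=> //.
    exact: joverlap_cod.
  exact: smooth_eq si.
rewrite -(derive_model_coord i e (jcoord c d u)); symmetry.
apply: derive_near; last exact: smooth_differentiable si co.
by apply: filterS (open_near oO co) => y /E1.
Qed.

Lemma dcoord_tcoord e a : dcoord c d e u (tcoord c a) = e.1.1 0 a.
Proof. exact: (dcoord_jcoord e (inl (inl a))). Qed.

Lemma dcoord_xcoord e i : dcoord c d e u (xcoord d i) = e.1.2 0 i.
Proof. exact: (dcoord_jcoord e (inl (inr i))). Qed.

Context (N : nonlinear_connection E).

Lemma HT_del_t (l : 'I_m -> R) : HT N u (\sum_a l a *: del_t N c d a u).
Proof. by exists c, d; split=> //; exists l. Qed.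

Lemma HM_del_x (k : 'I_n -> R) : HM N u (\sum_i k i *: del_x N c d i u).
Proof. by exists c, d; split=> //; exists k. Qed.

Lemma HT0 : HT N u 0.
Proof.
rewrite (_ : 0 = \sum_a 0 *: del_t N c d a u); first exact: HT_del_t.
by rewrite big1 // => a _; rewrite scale0r.
Qed.

Lemma HM0 : HM N u 0.
Proof.
rewrite (_ : 0 = \sum_i 0 *: del_x N c d i u); first exact: HM_del_x.
by rewrite big1 // => a _; rewrite scale0r.
Qed.

Lemma vert_dp_lincomb (q : 'I_m -> 'I_n -> R) :
  vert u (\sum_f \sum_r q f r *: dp c d f r u).
Proof.
rewrite (pair_bigA _ (fun f r => q f r *: dp c d f r u)) /=.
by apply: vert_lincomb => p; exact: vert_dp.
Qed.

Lemma del_t_xfun c' d' a (g : M -> R) : atlas c' -> atlas d' -> jdom c' d' u ->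
  del_t N c' d' a u (fun w => g (jproj w).2) = 0.
Proof.
move=> Ac' Ad' cdu'; rewrite del_tE frame_field_atE dcoord_xfun // sub0r.
rewrite big1 ?oppr0 // => b _; rewrite big1 // => j _.
by rewrite /dp dcoord_xfun // mulr0.
Qed.

Lemma del_x_tfun c' d' i (g : T -> R) : atlas c' -> atlas d' -> jdom c' d' u ->
  del_x N c' d' i u (fun w => g (jproj w).1) = 0.
Proof.
move=> Ac' Ad' cdu'; rewrite del_xE frame_field_atE dcoord_tfun // sub0r.
rewrite big1 ?oppr0 // => b _; rewrite big1 // => j _.
by rewrite /dp dcoord_tfun // mulr0.
Qed.

Lemma del_t_tcoord a b : del_t N c d a u (tcoord c b) = (b == a)%:R.
Proof.
rewrite del_tE frame_field_atE dcoord_tcoord mxE eqxx /= big1 ?subr0 // => f _.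
by rewrite big1 // => r _; rewrite /dp dcoord_tcoord mxE mulr0.
Qed.

Lemma del_x_xcoord i j : del_x N c d i u (xcoord d j) = (j == i)%:R.
Proof.
rewrite del_xE frame_field_atE dcoord_xcoord mxE eqxx /= big1 ?subr0 // => f _.
by rewrite big1 // => r _; rewrite /dp dcoord_xcoord mxE mulr0.
Qed.

Lemma lincomb_eval (I : finType) (k : I -> R) (v : I -> tvector E) f i :
  (forall j, v j f = (i == j)%:R) -> (\sum_j k j *: v j) f = k i.
Proof.
move=> vf; rewrite fct_sumE (bigD1 i) //= big1 => [|j ji].
  by rewrite fctE vf eqxx addr0 /GRing.scale /= mulr1.
by rewrite fctE vf eq_sym (negbTE ji) scaler0.
Qed.

Lemma lincomb_eval0 (I : finType) (k : I -> R) (v : I -> tvector E) f :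
  (forall j, v j f = 0) -> (\sum_j k j *: v j) f = 0.
Proof.
by move=> vf; rewrite fct_sumE big1 // => j _; rewrite fctE vf scaler0.
Qed.

Lemma HT_xfun v (g : M -> R) : HT N u v -> v (fun w => g (jproj w).2) = 0.
Proof.
move=> [c' [d' [Ac' Ad' cdu' [l ->]]]].
by apply: lincomb_eval0 => a; exact: del_t_xfun.
Qed.

Lemma HM_tfun v (g : T -> R) : HM N u v -> v (fun w => g (jproj w).1) = 0.
Proof.
move=> [c' [d' [Ac' Ad' cdu' [l ->]]]].
by apply: lincomb_eval0 => a; exact: del_x_tfun.
Qed.

(** The components are recovered by duality between the adapted basis and the
    coordinate functions of the base. *)
Lemma hor_expansion v : hor N u v ->
  v = \sum_a v (tcoord c a) *: del_t N c d a u
    + \sum_i v (xcoord d i) *: del_x N c d i u.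
Proof.
rewrite (hor_span N Ac Ad cdu) => -[l [k vE]]; rewrite {1}vE.
congr (_ + _); apply: eq_bigr => a _; congr (_ *: _); rewrite vE fctE.
  rewrite (@lincomb_eval _ l _ _ a) => [|b]; last exact: del_t_tcoord.
  rewrite lincomb_eval0 ?addr0 // => i.
  exact: (del_x_tfun i (fun t => cmap c t 0 a)).
rewrite (@lincomb_eval _ k _ _ a) => [|b]; last exact: del_x_xcoord.
rewrite lincomb_eval0 ?add0r // => i.
exact: (del_t_xfun i (fun x => cmap d x 0 a)).
Qed.

Lemma HT_hor v : HT N u v -> hor N u v.
Proof.
move=> [c' [d' [Ac' Ad' cdu' [l ->]]]]; rewrite (hor_span N Ac' Ad' cdu').
exists l, (fun _ => 0); rewrite [X in _ = _ + X]big1 ?addr0 // => i _.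
by rewrite scale0r.
Qed.

Lemma HM_hor v : HM N u v -> hor N u v.
Proof.
move=> [c' [d' [Ac' Ad' cdu' [k ->]]]]; rewrite (hor_span N Ac' Ad' cdu').
exists (fun _ => 0), k; rewrite [X in _ = X + _]big1 ?add0r // => i _.
by rewrite scale0r.
Qed.

(** The vectors [vT] and [vM] may be given as combinations in charts other than
    [(c, d)], but they are horizontal, hence expand in the adapted basis of
    [(c, d)], where [vT] has no [x]-component and [vM] no [t]-component. *)
Lemma decomp_expansion v vT vM vW : decomp N u v vT vM vW ->
  vT = \sum_a v (tcoord c a) *: del_t N c d a u /\
  vM = \sum_i v (xcoord d i) *: del_x N c d i u.
Proof.
move=> [hvT hvM [_ vW0] ->].
split.
  rewrite [LHS](hor_expansion (HT_hor hvT)).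
  rewrite [X in _ + X = _]big1 ?addr0 => [|i _]; last first.
    by rewrite (HT_xfun (fun x => cmap d x 0 i) hvT) scale0r.
  apply: eq_bigr => a _; rewrite !fctE; congr (_ *: _).
  rewrite (HM_tfun (fun t => cmap c t 0 a) hvM) addr0.
  by rewrite (vW0 (fun z => cmap c z.1 0 a)) addr0.
rewrite [LHS](hor_expansion (HM_hor hvM)).
rewrite [X in X + _ = _]big1 ?add0r => [|a _]; last first.
  by rewrite (HM_tfun (fun t => cmap c t 0 a) hvM) scale0r.
apply: eq_bigr => i _; rewrite !fctE; congr (_ *: _).
rewrite (HT_xfun (fun x => cmap d x 0 i) hvT) add0r.
by rewrite (vW0 (fun z => cmap d z.2 0 i)) addr0.
Qed.

Lemma decomp_projections (Z : vfield E) vT vM vW : decomp N u (Z u) vT vM vW ->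
  [/\ hT N Z u = vT, hM N Z u = vM & wV N Z u = vW].
Proof.
move=> dv; have [eT eM] := decomp_expansion dv.
have uniq vT' vM' vW' : decomp N u (Z u) vT' vM' vW' ->
    [/\ vT' = vT, vM' = vM & vW' = vW].
  move=> dv'; have [eT' eM'] := decomp_expansion dv'.
  have eqT : vT' = vT by rewrite eT' eT.
  have eqM : vM' = vM by rewrite eM' eM.
  split=> //; case: dv => _ _ _ ZE; case: dv' => _ _ _; rewrite ZE eqT eqM.
  by move/addrI.
split; apply: xget_unique.
- by exists vM, vW.
- by move=> v [vM' [vW' /uniq[]]].
- by exists vT, vW.
- by move=> v [vT' [vW' /uniq[]]].
- by exists vT, vM.
- by move=> v [vT' [vM' /uniq[]]].
Qed.

End Splitting.

(** * The torsion *)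

Lemma sumrB_lincomb (R : nzRingType) (V : lmodType R) (I : finType)
    (k l : I -> R) (v : I -> V) :
  \sum_i k i *: v i - \sum_i l i *: v i = \sum_i (k i - l i) *: v i.
Proof. by rewrite -sumrB; apply: eq_bigr => i _; rewrite scalerBl. Qed.

Lemma sumrD_lincomb2 (R : nzRingType) (V : lmodType R) (I J : finType)
    (k l : I -> J -> R) (v : I -> J -> V) :
  \sum_i \sum_j k i j *: v i j + \sum_i \sum_j l i j *: v i j
    = \sum_i \sum_j (k i j + l i j) *: v i j.
Proof.
rewrite -big_split; apply: eq_bigr => i _; rewrite -big_split.
by apply: eq_bigr => j _; rewrite scalerDl.
Qed.

Lemma sumrB_lincomb2 (R : nzRingType) (V : lmodType R) (I J : finType)
    (k l : I -> J -> R) (v : I -> J -> V) :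
  \sum_i \sum_j k i j *: v i j - \sum_i \sum_j l i j *: v i j
    = \sum_i \sum_j (k i j - l i j) *: v i j.
Proof. by rewrite -sumrB; apply: eq_bigr => i _; exact: sumrB_lincomb. Qed.

Section Torsion.
Context {R : realType} {m n : nat} {T : manifold R m} {M : manifold R n}.
Context {E : dual_jet_bundle T M} {N : nonlinear_connection E}.
Context {c : chart R T m} {d : chart R M n} (Ac : atlas c) (Ad : atlas d).
Context {u : E} (cdu : jdom c d u).

Lemma smooth_at_jsmooth (f : E -> R) : jsmooth (jdom c d) f -> smooth_at u f.
Proof.
move=> sf; apply/(smooth_atP f Ac Ad cdu); exists (joverlap c d c d).
split; [exact: joverlap_open|exact: joverlap_cod|exact: joverlap_jcoord|].
apply: smooth_sub (sf c d Ac Ad) => y oy.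
have [_ cdy _ yE] := joverlap_jinv (E:=E) Ac Ad oy.
by exists (jinv E c d y).
Qed.

Lemma torsion_projections (D : linear_connection E) X Y vT vM
    (q : 'I_m -> 'I_n -> R) :
  HT N u vT -> HM N u vM ->
  torsion D X Y u = vT + vM + \sum_f \sum_r q f r *: dp c d f r u ->
  [/\ hT N (torsion D X Y) u = vT, hM N (torsion D X Y) u = vM &
      wV N (torsion D X Y) u = \sum_f \sum_r q f r *: dp c d f r u].
Proof.
move=> hvT hvM TE; apply: (decomp_projections Ac Ad cdu); split=> //.
exact: vert_dp_lincomb.
Qed.

End Torsion.

Theorem theorem7p4 (R : realType) (m n : nat)
    (T : manifold R m) (M : manifold R n) (E : dual_jet_bundle T M)
    (N : nonlinear_connection E) (D : linear_connection E)
    (D_N_linear : N_linear N D)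
    (c : chart R T m) (d : chart R M n) (atlas_c : atlas c) (atlas_d : atlas d)
    (G : coefficients E) (DG : adapted_coefficients N D c d G)
    (u : E) (cd_u : jdom c d u) :
  let dt := del_t N c d in let dx := del_x N c d in let dp := dp (E:=E) c d in
  let TT := torsion D in
  [/\ forall a b : 'I_m,
      [/\ hT N (TT (dt b) (dt a)) u =
            \sum_e (At G e a b u - At G e b a u) *: dt e u,
          hM N (TT (dt b) (dt a)) u = 0 &
          wV N (TT (dt b) (dt a)) u =
            \sum_f \sum_r R_tt N c d f r a b u *: dp f r u],
      forall (a : 'I_m) (j : 'I_n),
      [/\ hT N (TT (dx j) (dt a)) u = \sum_e Ht G e a j u *: dt e u,
          hM N (TT (dx j) (dt a)) u = \sum_k (- Ax G k j a u) *: dx k u &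
          wV N (TT (dx j) (dt a)) u =
            \sum_f \sum_r R_tx N c d f r a j u *: dp f r u],
      forall (a b : 'I_m) (j : 'I_n),
      [/\ hT N (TT (dp b j) (dt a)) u = \sum_e Ct G e a b j u *: dt e u,
          hM N (TT (dp b j) (dt a)) u = 0 &
          wV N (TT (dp b j) (dt a)) u =
            \sum_f \sum_r
              (Bt N c d f r a b j u + Ap G f r b j a u) *: dp f r u],
      forall i j : 'I_n,
      [/\ hT N (TT (dx j) (dx i)) u = 0,
          hM N (TT (dx j) (dx i)) u =
            \sum_k (Hx G k i j u - Hx G k j i u) *: dx k u &
          wV N (TT (dx j) (dx i)) u =
            \sum_f \sum_r R_xx N c d f r i j u *: dp f r u] &
      (forall (i : 'I_n) (b : 'I_m) (j : 'I_n),
      [/\ hT N (TT (dp b j) (dx i)) u = 0,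
          hM N (TT (dp b j) (dx i)) u = \sum_k Cx G k i b j u *: dx k u &
          wV N (TT (dp b j) (dx i)) u =
            \sum_f \sum_r
              (Bx N c d f r i b j u + Hp G f r b j i u) *: dp f r u]) /\
      (forall (a : 'I_m) (i : 'I_n) (b : 'I_m) (j : 'I_n),
      [/\ hT N (TT (dp b j) (dp a i)) u = 0,
          hM N (TT (dp b j) (dp a i)) u = 0 &
          wV N (TT (dp b j) (dp a i)) u =
            \sum_f \sum_r
              (- (Cp G f r a i b j u - Cp G f r b j a i u)) *: dp f r u])].
Proof.
move=> dt dx dp TT.
have [[Dtt Dtx Dtp] [Dxt Dxx Dxp] [Dpt Dpx Dpp]] := DG u cd_u.
have sN1 f r a : smooth_at u (N1 N c d f r a).
  by apply: (smooth_at_jsmooth atlas_c atlas_d) => //; exact: N1_smooth.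
have sN2 f r i : smooth_at u (N2 N c d f r i).
  by apply: (smooth_at_jsmooth atlas_c atlas_d) => //; exact: N2_smooth.
have s0 : smooth_at u (cst 0 : E -> R).
  exact: (smooth_at_cst atlas_c atlas_d).
have frame0 e phi : frame_field c d e phi u (cst 0) = 0.
  by apply: (tangent_cst0 atlas_c atlas_d cd_u); exact: tangent_frame_field.
have lieE := lie_frame_field atlas_c atlas_d _ _ cd_u.
have TE X Y : torsion D X Y u = D X Y u - D Y X u + - lie X Y u by [].
have ht := HT_del_t atlas_c atlas_d cd_u N.
have hx := HM_del_x atlas_c atlas_d cd_u N.
have h0 := HT0 atlas_c atlas_d cd_u N.
have hx0 := HM0 atlas_c atlas_d cd_u N.
have proj := torsion_projections (N:=N) atlas_c atlas_d cd_u.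
split; last split.
- move=> a b; apply: (proj D (dt b) (dt a)) => //; rewrite TE.
  rewrite Dtt Dtt sumrB_lincomb addr0; congr (_ + _).
  by rewrite /dt del_tE del_tE lieE.
- move=> a j; apply: (proj D (dx j) (dt a)) => //; rewrite TE.
  rewrite Dxt Dtx; congr (_ + _ + _).
    by rewrite -sumrN; apply: eq_bigr => k _; rewrite scaleNr.
  by rewrite /dt /dx del_tE del_xE lieE.
- move=> a b j; apply: (proj D (dp b j) (dt a)) => //; rewrite TE.
  (* d/dp has no d/dp-correction, so only the coefficient N1 is differentiated *)
  rewrite Dpt Dtp opprK addr0 -addrA addrC.
  rewrite -sumrD_lincomb2 [in RHS]addrC [X in _ = X + _]addrC; congr (_ + _ + _).
  rewrite /dt /dp del_tE dpE lieE //.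
  by apply: eq_bigr => f _; apply: eq_bigr => r _; rewrite frame0 subr0 -dpE.
- move=> i j; apply: (proj D (dx j) (dx i)) => //; rewrite TE.
  rewrite Dxx Dxx sumrB_lincomb add0r; congr (_ + _).
  by rewrite /dx del_xE del_xE lieE.
- move=> i b j; apply: (proj D (dp b j) (dx i)) => //; rewrite TE.
  rewrite Dpx Dxp opprK add0r -addrA; congr (_ + _).
  rewrite -sumrD_lincomb2 addrC; congr (_ + _).
  rewrite /dx /dp del_xE dpE lieE //.
  by apply: eq_bigr => f _; apply: eq_bigr => r _; rewrite frame0 subr0 -dpE.
- move=> a i b j; apply: (proj D (dp b j) (dp a i)) => //; rewrite !add0r TE.
  rewrite Dpp Dpp opprK /dp (dpE _ _ b j) (dpE _ _ a i) lieE //.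
  (* the fields d/dp have constant coefficients and therefore commute *)
  rewrite [X in _ + X = _]big1 ?addr0 => [|f _]; last first.
    by rewrite big1 // => r _; rewrite !frame0 subr0 scale0r.
  rewrite [LHS]addrC sumrB_lincomb2.
  by apply: eq_bigr => f _; apply: eq_bigr => r _; rewrite opprB.
Qed.
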